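(* Let $p\in(1,\infty)$, let $u\in U_{\mathrm{ad}}$ be given and let $(\hat n,\hat a,\hat t)$ be its full representation. Then $u$ is locally optimal for problem (P) in $L^1(0,T)^M$ if and only if $\hat t$ is locally optimal for the switching-point problem $\mathrm{ST}(\hat n,\hat a)$. Moreover, $u$ satisfies a local quadratic growth condition for (P) in $L^1(0,T)^M$ if and only if a local quadratic growth condition is valid for $\mathrm{ST}(\hat n,\hat a)$ at $\hat t$; that is, the existence of constants $\varepsilon,\eta>0$ such that $$F(w)+\beta\,\mathrm{TV}_p(w)\ \ge\ F(u)+\beta\,\mathrm{TV}_p(u)+\frac{\eta}{2}\|w-u\|_{L^1}^2\qquad\forall w\in U_{\mathrm{ad}},\ \|w-u\|_{L^1}\le\varepsilon$$ is equivalent to the existence of constants $\tilde\varepsilon,\tilde\eta>0$ such that $$F(v^{\hat s,\hat a})\ \ge\ F(u)+\frac{\tilde\eta}{2}\|\hat s-\hat t\|_2^2\qquad\forall \hat s\in\mathcal F,\ \|\hat s-\hat t\|_2\le\tilde\varepsilon,$$ where $\mathcal F=\{s\in\mathbb R^{\hat n-1}: 0\le s_1\le\dots\le s_{\hat n-1}\le T\}$ is the feasible set of $\mathrm{ST}(\hat n,\hat a)$.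
   Context: Let $T>0$, $M\in\mathbb N$, $\beta>0$, and let $\mathcal V=\{\nu_1,\dots,\nu_d\}\subset\mathbb Z^M$ be a finite set with $d\ge2$ elements. The functional $F:L^1(0,T)^M\to\mathbb R$ is bounded from below, lower semicontinuous and Gâteaux differentiable. Write $\|v\|_q$ for the $q$-norm on $\mathbb R^M$, and $\|u\|_{L^1}=\int_0^T\|u(t)\|_1\,dt$. For $p\in[1,\infty]$ with Hölder conjugate $p'$ and $u\in L^1(0,T)^M$ let $$\mathrm{TV}_p(u)=\sup\Big\{\int_0^T u^\top\varphi'\,dt : \varphi\in C_c^1(0,T)^M,\ \|\varphi(t)\|_{p'}\le1\ \forall t\in(0,T)\Big\}.$$ Set $U_{\mathrm{ad}}=\{u\in BV(0,T)^M: u(t)\in\mathcal V\text{ for a.a. }t\in(0,T)\}$. Problem (P) is: minimize $F(u)+\beta\,\mathrm{TV}_p(u)$ over $u\in U_{\mathrm{ad}}$. ''Locally optimal for (P) in $L^1(0,T)^M$'' means that $F(w)+\beta\mathrm{TV}_p(w)\ge F(u)+\beta\mathrm{TV}_p(u)$ for all $w\in U_{\mathrm{ad}}$ with $\|w-u\|_{L^1}\le\varepsilon$, for some $\varepsilon>0$. For $n\in\mathbb N$, $a=(a_1,\dots,a_n)\in(\mathbb R^M)^n$, and $t\in\mathbb R^{n-1}$ with $0=t_0\le t_1\le\dots\le t_{n-1}\le t_n=T$, put $v^{t,a}=a_1\chi_{(t_0,t_1)}+\sum_{j=2}^n a_j\chi_{[t_{j-1},t_j)}$. The switching-point problem $\mathrm{ST}(n,a)$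 is: minimize $F(v^{t,a})$ over $t\in\mathbb R^{n-1}$ with $0\le t_1\le\dots\le t_{n-1}\le T$ (local optimality is w.r.t. this feasible set and the Euclidean norm). Full representation: for $u\in U_{\mathrm{ad}}$, the full representation is the (unique) triple $(\hat n,\hat a,\hat t)$ with $\hat n\in\mathbb N$, $\hat a\in\mathcal V^{\hat n}$, $\hat t\in\mathbb R^{\hat n-1}$ such that (i) $u=v^{\hat t,\hat a}$ (a.e.); (ii) with $\hat t_0=0$, $\hat t_{\hat n}=T$: $\hat t_i\le\hat t_{i+1}$ for all $i\in\{0,\dots,\hat n-1\}$, and if $\hat n\ge 2$ then $0<\hat t_1$ and $\hat t_{\hat n-1}<T$; (iii) whenever $i\le j$ in $\{1,\dots,\hat n-1\}$ satisfy $\hat t_{i-1}<\hat t_i=\hat t_j<\hat t_{j+1}$, one can write $\hat a_k=(1-\lambda_k)\hat a_i+\lambda_k\hat a_{j+1}$, $k=i+1,\dots,j$, for a strictly increasing sequence $\lambda_{i+1},\dots,\lambda_j\in(0,1)$, and this sequence contains every element of $\{\lambda\in(0,1):(1-\lambda)\hat a_i+\lambda\hat a_{j+1}\in\mathcal V\}$ (for $i=j$ the sequence is empty, so this set must be empty). *)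

(* Defs.v *)
From HB Require Import structures.
From mathcomp Require Import all_boot all_order all_algebra finmap.
From mathcomp Require Import all_classical all_reals all_analysis.

Set Implicit Arguments.
Unset Strict Implicit.
Unset Printing Implicit Defensive.

Import Order.TTheory GRing.Theory Num.Theory.
Import numFieldNormedType.Exports.

Local Open Scope classical_set_scope.
Local Open Scope ring_scope.

Section Definitions.
Context {R : realType}.

(* The q-norm on R^M, for q in [1, +oo]; the value at q = -oo is junk. *)
Definition vnorm (M : nat) (q : \bar R) (v : 'rV[R]_M) : R :=
  match q with
  | q%:E => (\sum_i `|v 0 i| `^ q) `^ q^-1
  | +oo%E => \big[Num.max/0]_i `|v 0 i|
  | -oo%E => 0
  end.

Section FunctionSpaces.
Context {M : nat} (T : R).
Implicit Types u w h phi : R -> 'rV[R]_M.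

(* L^1(0,T)^M is represented by functions defined on all of R, of which only
   the values on (0,T), up to a null set, are meaningful. *)
Definition inL1 u : Prop :=
  forall i, lebesgue_measure.-integrable `]0, T[
              (fun t => (u t 0 i)%:E).

Definition ae_equal u w : Prop :=
  {ae lebesgue_measure, forall t : R, t \in `]0, T[ -> u t = w t}.

Definition L1norm u : R :=
  \int[lebesgue_measure]_(t in `]0, T[) vnorm 1 (u t).

(* C_c^1(0,T)^M, each function being extended by zero to R. *)
Definition C1c phi : Prop :=
  [/\ forall i t, derivable (fun x => phi x 0 i) t 1,
      forall i, continuous (derive1 (fun x => phi x 0 i)),
      compact (closure [set t | phi t != 0])
    & closure [set t | phi t != 0] `<=` `]0, T[].

Definition TV (p : \bar R) u : \bar R :=
  ereal_sup [set (\int[lebesgue_measure]_(t in `]0, T[)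
                    \sum_i u t 0 i * derive1 (fun x => phi x 0 i) t)%:E
            | phi in [set phi | C1c phi /\
                forall t, t \in `]0, T[ ->
                  vnorm (hoelder_conjugate p) (phi t) <= 1]].

End FunctionSpaces.

(* BV(0,T)^M, componentwise; on R^1 all q-norms coincide, so that the exponent
   1 in the scalar total variation is immaterial. *)
Definition inBV (M : nat) (T : R) (u : R -> 'rV[R]_M) : Prop :=
  inL1 T u /\
  forall i, (TV T 1 (fun t => \row_(_ < 1) u t 0%R i) < +oo)%E.

Section Functionals.
Context {M : nat} (T : R) (F : (R -> 'rV[R]_M) -> R).

(* F is a function of classes modulo equality a.e. on (0,T). *)
Definition ae_invariant : Prop :=
  forall u w, inL1 T u -> inL1 T w -> ae_equal T u w -> F u = F w.

Definition bounded_below : Prop :=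
  exists c : R, forall u, inL1 T u -> c <= F u.

Definition L1_lower_semicontinuous : Prop :=
  forall u, inL1 T u -> forall e : R, 0 < e ->
    exists2 d : R, 0 < d &
      forall w, inL1 T w -> L1norm T (w - u) < d -> F u - e < F w.

(* At every point the directional derivatives exist and define a bounded
   linear functional of the direction. *)
Definition gateaux_differentiable : Prop :=
  forall u, inL1 T u -> exists dF : (R -> 'rV[R]_M) -> R,
    [/\ forall (c : R) h k, inL1 T h -> inL1 T k ->
          dF (c *: h + k) = c * dF h + dF k,
        exists C : R, forall h, inL1 T h -> `|dF h| <= C * L1norm T h
      & forall h, inL1 T h ->
          s^-1 * (F (u + s *: h) - F u) @[s --> (0 : R)^'] --> dF h].

End Functionals.

Section ProblemP.
Context {M : nat} (T : R) (V : {fset 'rV[int]_M}) (beta : R) (p : \bar R)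
  (F : (R -> 'rV[R]_M) -> R).
Implicit Types u w : R -> 'rV[R]_M.

(* V as a subset of R^M. *)
Definition valset : set 'rV[R]_M :=
  [set map_mx (intr : int -> R) nu | nu in [set` V]].

Definition Uad u : Prop :=
  inBV T u /\
  {ae lebesgue_measure, forall t : R, t \in `]0, T[ -> valset (u t)}.

Definition objective u : \bar R := ((F u)%:E + beta%:E * TV T p u)%E.

Definition locally_optimal_P u : Prop :=
  exists2 e : R, 0 < e &
    forall w, Uad w -> L1norm T (w - u) <= e -> (objective u <= objective w)%E.

Definition quadratic_growth_P u : Prop :=
  exists e eta : R, [/\ 0 < e, 0 < eta &
    forall w, Uad w -> L1norm T (w - u) <= e ->
      (objective u + (eta / 2 * L1norm T (w - u) ^+ 2)%:E <= objective w)%E].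

End ProblemP.

(* Throughout, m = n - 1 >= 0 is the number of switching points. *)
Section SwitchingPoints.
Context {M m : nat} (T : R).
Implicit Types (t s : 'rV[R]_m) (a : 'I_m.+1 -> 'rV[R]_M).

(* t_k for 0 <= k <= n, with t_0 = 0 and t_n = T; t_k is the entry of index
   k - 1 of the row vector t when 0 < k < n. *)
Definition node t (k : nat) : R :=
  if k is k'.+1 then oapp (fun i : 'I_m => t 0 i) T (insub k') else 0.

(* a_k for 1 <= k <= n. *)
Definition level a (k : nat) : 'rV[R]_M := a (inord k.-1).

Definition piece t (j : nat) : set R :=
  if j == 1%N then `]node t 0, node t 1[%classic
  else `[node t j.-1, node t j[%classic.

(* v^{t,a} *)
Definition vfun t a : R -> 'rV[R]_M :=
  fun x => \sum_(1 <= j < m.+2) \1_(piece t j) x *: level a j.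

Definition feasible t : Prop :=
  forall k, (k <= m)%N -> node t k <= node t k.+1.

Definition locally_optimal_ST (F : (R -> 'rV[R]_M) -> R) a t : Prop :=
  feasible t /\
  exists2 e : R, 0 < e &
    forall s, feasible s -> vnorm 2%:E (s - t) <= e ->
      F (vfun t a) <= F (vfun s a).

Definition quadratic_growth_ST (F : (R -> 'rV[R]_M) -> R)
    (u : R -> 'rV[R]_M) a t : Prop :=
  exists e eta : R, [/\ 0 < e, 0 < eta &
    forall s, feasible s -> vnorm 2%:E (s - t) <= e ->
      F u + eta / 2 * vnorm 2%:E (s - t) ^+ 2 <= F (vfun s a)].

Definition full_representation (V : {fset 'rV[int]_M}) (u : R -> 'rV[R]_M)
    a t : Prop :=
  [/\ forall j, valset V (a j),
      ae_equal T u (vfun t a),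
      feasible t /\ ((0 < m)%N -> 0 < node t 1 /\ node t m < T)
    & forall i j : nat, (1 <= i)%N -> (i <= j)%N -> (j <= m)%N ->
        node t i.-1 < node t i -> node t i = node t j ->
        node t j < node t j.+1 ->
        let line x := (1 - x) *: level a i + x *: level a j.+1 in
        exists lam : nat -> R,
          [/\ forall k, (i < k <= j)%N ->
                0 < lam k < 1 /\ level a k = line (lam k),
              forall k l, (i < k)%N -> (k < l)%N -> (l <= j)%N ->
                lam k < lam l
            & forall x : R, 0 < x < 1 -> valset V (line x) ->
                exists2 k, (i < k <= j)%N & lam k = x]].

End SwitchingPoints.
End Definitions.

(* Main.v *)
(* The p-total variation of a V-valued function is the sum of the p-norms of its
   jumps, so moving the switching points of [u] never increases it; this gives
   "only if".  Conversely, let [w] be admissible and close to [u] in L^1.  At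
   Lebesgue points x < y, the increment of the p-variation of [w] from (0,x) to
   (0,y) is at least the p-norm of w(y) - w(x): add to a test function on (0,x) a
   C^1 bump that rises at [x] and falls before [y].  On every nondegenerate piece
   of [u] there is a Lebesgue point where [w] agrees with [u], hence
   TV(w) >= TV(u).  As V is finite and the p-norm is strictly convex, either
   TV(w) >= TV(u) + delta, and lower semicontinuity of F settles the matter, or
   between two such points [w] runs monotonically through the elements of V on the
   segment joining the two levels.  Then w = v^{s,a} a.e. for some feasible [s], and
   near [t] the L^1 distance of v^{s,a} and [u] is comparable to |s - t|. *)

Require Import Defs.
From HB Require Import structures.
From mathcomp Require Import all_boot all_order all_algebra finmap.
From mathcomp Require Import all_classical all_reals all_analysis.
From mathcomp Require Import measurable_realfun ring lra zify.

Set Implicit Arguments.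
Unset Strict Implicit.
Unset Printing Implicit Defensive.

Import Order.TTheory GRing.Theory Num.Theory.
Import numFieldNormedType.Exports.

Local Open Scope classical_set_scope.
Local Open Scope ring_scope.

(** * The p-norm *)

(** An admissible [w] is known only almost everywhere, and no step form of it is presupposed: only
    its values at interior Lebesgue points are used, and the switching times are recovered as
    infima. The obstacle is that a level does not determine a piece, since a vector may recur in [a]
    and switching points of [t] may coincide. Indices are therefore assigned relative to base
    points, one in each nondegenerate piece of [u]. Between neighbouring base points the levels are
    strictly ordered on a segment, hence distinct, and they exhaust the elements of V there; so each
    value of [w] gets exactly one index. The constant [delta] is at most 1 and at most the least
    positive excess of a path through four elements of V over the distance of its ends. Four points
    are used so that two intermediate values are ordered along the segment at once. Integrality puts
    distinct values at least 1 apart in the 1-norm, which bounds |s_i - t_i| by the L^1 distance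
    with constant 1. *)

Section VectorNorm.
Context {R : realType}.
Implicit Types p q : R.

Lemma le_addr_eq (a b c d : R) :
  a <= c -> b <= d -> a + b = c + d -> a = c /\ b = d.
Proof. by move=> ac bd E; split; lra. Qed.

(** With u = p ln a and v = q ln b, the product ab is exp of the weighted mean m of u and v. The
    tangent of exp at m lies below exp, strictly so away from m; averaging it at u and v makes
    Young's inequality strict unless u = v. Zero arguments are split off because of the
    logarithm. *)
Lemma young_eq (a b p q : R) : 0 <= a -> 0 <= b -> 0 < p -> 0 < q ->
  p^-1 + q^-1 = 1 -> a * b = a `^ p / p + b `^ q / q -> a `^ p = b `^ q.
Proof.
move=> a0 b0 p0 q0 pq.
have [->|an0] := eqVneq a 0.
  rewrite mul0r powR0 ?gt_eqF// mul0r add0r => /esym/eqP.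
  by rewrite mulf_eq0 invr_eq0 (gt_eqF q0) orbF => /eqP ->.
have [->|bn0] := eqVneq b 0.
  rewrite mulr0 powR0 ?gt_eqF// mul0r addr0 => /esym/eqP.
  by rewrite mulf_eq0 invr_eq0 (gt_eqF p0) orbF => /eqP ->.
have ap : 0 < a by rewrite lt_neqAle eq_sym an0.
have bp : 0 < b by rewrite lt_neqAle eq_sym bn0.
rewrite /powR (negbTE an0) (negbTE bn0).
set u := p * ln a; set v := q * ln b.
have [m mE] : exists m, m = u / p + v / q by eexists.
have -> : a * b = expR m.
  rewrite mE /u /v mulrAC divff ?gt_eqF// mul1r mulrAC divff ?gt_eqF// mul1r.
  by rewrite expRD !lnK.
move=> E; have [->//|uv] := eqVneq u v.
have umv : (u - m) / p + (v - m) / q = 0.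
  have -> : (u - m) / p + (v - m) / q = u / p + v / q - m * (p^-1 + q^-1) by ring.
  by rewrite pq mulr1 -mE subrr.
have qi : 0 < q^-1 by rewrite invr_gt0.
have pi : 0 < p^-1 by rewrite invr_gt0.
have qE : q^-1 = 1 - p^-1 by rewrite -pq; ring.
have um : u - m != 0.
  have -> : u - m = (u - v) / q by rewrite mE qE; ring.
  by rewrite mulf_neq0// ?subr_eq0// gt_eqF.
have e0 := expR_gt0 m.
have Eu : expR m * (1 + (u - m)) < expR u.
  by rewrite -[in ltRHS](subrK m u) expRD mulrC ltr_pM2r// expR_gt1Dx.
have Ev : expR m * (1 + (v - m)) <= expR v.
  by rewrite -[in leRHS](subrK m v) expRD mulrC ler_pM2r// expR_ge1Dx.
have : expR m < expR u / p + expR v / q.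
  apply: (@lt_le_trans _ _ (expR u / p + expR m * (1 + (v - m)) / q)); last first.
    by rewrite lerD2l ler_pM2r.
  have mS : expR m = expR m * (1 + (u - m)) / p + expR m * (1 + (v - m)) / q.
    rewrite -[LHS]mulr1 -{1}pq.
    transitivity (expR m * (p^-1 + q^-1) + expR m * ((u - m) / p + (v - m) / q)).
      by rewrite umv mulr0 addr0.
    ring.
  by rewrite [ltLHS]mS ltrD2r ltr_pM2r.
by rewrite E ltxx.
Qed.

Context {n : nat}.
Implicit Types x y z : 'rV[R]_n.

Definition dotp x y : R := \sum_i x 0 i * y 0 i.

Lemma dotpDl x y z : dotp (x + y) z = dotp x z + dotp y z.
Proof. by rewrite -big_split; apply: eq_bigr => i _; rewrite mxE mulrDl. Qed.

Lemma dotpZl c x y : dotp (c *: x) y = c * dotp x y.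
Proof. by rewrite /dotp mulr_sumr; apply: eq_bigr => i _; rewrite mxE mulrA. Qed.

Lemma dotpZr c x y : dotp x (c *: y) = c * dotp x y.
Proof. by rewrite /dotp mulr_sumr; apply: eq_bigr => i _; rewrite mxE mulrCA. Qed.

Lemma dotpNr x y : dotp x (- y) = - dotp x y.
Proof. by rewrite -scaleN1r dotpZr mulN1r. Qed.

Lemma scalerV_inj (a b : R) x y : a != 0 -> b != 0 ->
  a^-1 *: x = b^-1 *: y -> b *: x = a *: y.
Proof.
move=> a0 b0 /(congr1 (fun v => (b * a) *: v)).
by rewrite !scalerA mulfK// mulrAC divff// mul1r.
Qed.

Lemma vnormE p x : vnorm p%:E x = (\sum_i `|x 0 i| `^ p) `^ p^-1.
Proof. by []. Qed.

Lemma sum_powR_ge0 p x : 0 <= \sum_i `|x 0 i| `^ p.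
Proof. by apply: sumr_ge0 => i _; exact: powR_ge0. Qed.

Lemma vnorm_ge0 p x : 0 <= vnorm p%:E x.
Proof. by rewrite vnormE; exact: powR_ge0. Qed.

Lemma vnormK p x : 0 < p -> vnorm p%:E x `^ p = \sum_i `|x 0 i| `^ p.
Proof. by move=> p0; rewrite vnormE -powRrM mulVf ?gt_eqF// powRr1// sum_powR_ge0. Qed.

Lemma vnorm0 p : 0 < p -> vnorm p%:E (0 : 'rV[R]_n) = 0.
Proof.
move=> p0; rewrite vnormE big1 ?powR0 ?invr_eq0 ?gt_eqF// => i _.
by rewrite mxE normr0 powR0 ?gt_eqF.
Qed.

Lemma vnormZ p c x : 0 < p -> vnorm p%:E (c *: x) = `|c| * vnorm p%:E x.
Proof.
move=> p0; rewrite !vnormE.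
under eq_bigr do rewrite mxE normrM powRM//.
rewrite -mulr_sumr powRM ?powR_ge0 ?sum_powR_ge0//.
by rewrite -powRrM divff ?gt_eqF// powRr1.
Qed.

Lemma vnormN p x : 0 < p -> vnorm p%:E (- x) = vnorm p%:E x.
Proof. by move=> p0; rewrite -scaleN1r vnormZ// normrN1 mul1r. Qed.

Lemma le_entry_vnorm p x i : 0 < p -> `|x 0 i| <= vnorm p%:E x.
Proof.
move=> p0; have pi : 0 < p^-1 by rewrite invr_gt0.
have -> : `|x 0 i| = (`|x 0 i| `^ p) `^ p^-1.
  by rewrite -powRrM divff ?gt_eqF// powRr1.
apply: ge0_ler_powR; rewrite ?nnegrE ?powR_ge0 ?sum_powR_ge0 ?(ltW pi)//.
by rewrite (bigD1 i)//= lerDl sumr_ge0// => j _; exact: powR_ge0.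
Qed.

Lemma vnorm_eq0 p x : 0 < p -> (vnorm p%:E x == 0) = (x == 0).
Proof.
move=> p0; apply/eqP/eqP => [x0|->]; last exact: vnorm0.
apply/rowP => i; rewrite mxE; apply/normr0_eq0/eqP.
by rewrite eq_le normr_ge0 andbT -x0 le_entry_vnorm.
Qed.

Lemma vnorm_gt0 p x : 0 < p -> x != 0 -> 0 < vnorm p%:E x.
Proof. by move=> p0 x0; rewrite lt_neqAle eq_sym vnorm_eq0 ?x0 ?vnorm_ge0. Qed.

Lemma vnorm_normalize p x : 0 < p -> x != 0 ->
  vnorm p%:E ((vnorm p%:E x)^-1 *: x) = 1.
Proof.
move=> p0 x0; rewrite vnormZ// normfV (ger0_norm (vnorm_ge0 _ _)) mulVf//.
by rewrite vnorm_eq0.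
Qed.

Lemma vnorm1E x : vnorm 1%:E x = \sum_i `|x 0 i|.
Proof.
rewrite vnormE invr1 powRr1 ?sum_powR_ge0//.
by apply: eq_bigr => i _; rewrite powRr1.
Qed.

Section Conjugate.
Variables (p q : R).
Hypotheses (p0 : 0 < p) (q0 : 0 < q) (pq : p^-1 + q^-1 = 1).

Lemma dotp_unit x y : vnorm p%:E x = 1 -> vnorm q%:E y = 1 -> dotp x y <= 1.
Proof.
move=> x1 y1.
have Sx : \sum_i `|x 0 i| `^ p = 1 by rewrite -vnormK// x1 powR1.
have Sy : \sum_i `|y 0 i| `^ q = 1 by rewrite -vnormK// y1 powR1.
have -> : 1 = \sum_i (`|x 0 i| `^ p / p + `|y 0 i| `^ q / q).
  by rewrite big_split -!mulr_suml Sx Sy !mul1r.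
apply: ler_sum => i _; apply: le_trans (ler_norm _) _.
by rewrite normrM conjugate_powR.
Qed.

Lemma dotp_unit_eq x y : vnorm p%:E x = 1 -> vnorm q%:E y = 1 -> dotp x y = 1 ->
  forall i, x 0 i * y 0 i = `|x 0 i| * `|y 0 i| /\ `|x 0 i| `^ p = `|y 0 i| `^ q.
Proof.
move=> x1 y1 xy i.
have Sx : \sum_i `|x 0 i| `^ p = 1 by rewrite -vnormK// x1 powR1.
have Sy : \sum_i `|y 0 i| `^ q = 1 by rewrite -vnormK// y1 powR1.
have E1 : \sum_i (`|x 0 i| `^ p / p + `|y 0 i| `^ q / q) = 1.
  by rewrite big_split -!mulr_suml Sx Sy !mul1r.
have le1 j : x 0 j * y 0 j <= `|x 0 j| * `|y 0 j| by rewrite -normrM ler_norm.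
have le2 j : `|x 0 j| * `|y 0 j| <= `|x 0 j| `^ p / p + `|y 0 j| `^ q / q.
  exact: conjugate_powR.
have F j : 0 <= (`|x 0 j| `^ p / p + `|y 0 j| `^ q / q) - x 0 j * y 0 j.
  by rewrite subr_ge0 (le_trans (le1 j)).
have : \sum_i (`|x 0 i| `^ p / p + `|y 0 i| `^ q / q - x 0 i * y 0 i) = 0.
  by rewrite sumrB E1 -/(dotp x y) xy subrr.
move=> /eqP; rewrite psumr_eq0// => /allP/(_ i).
rewrite mem_index_enum => /(_ isT)/= /eqP E.
have xyE : x 0 i * y 0 i = `|x 0 i| * `|y 0 i|.
  apply/eqP; rewrite eq_le le1/=; apply: le_trans (le2 i) _.
  by rewrite -subr_le0 E.
split=> //; apply: young_eq => //; apply/eqP; rewrite eq_le le2/= -xyE.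
by rewrite -subr_le0 E.
Qed.

(** Equality in Young's inequality at each coordinate fixes |x_i| through |z_i| and the sign of x_i
    through that of z_i; where z_i = 0, both coordinates vanish. This uniqueness is the source of
    strict convexity. *)
Lemma dotp_unit_inj x y z : vnorm p%:E x = 1 -> vnorm p%:E y = 1 ->
  vnorm q%:E z = 1 -> dotp x z = 1 -> dotp y z = 1 -> x = y.
Proof.
move=> x1 y1 z1 xz yz; apply/rowP => i.
have [Ex1 Ex2] := dotp_unit_eq x1 z1 xz i.
have [Ey1 Ey2] := dotp_unit_eq y1 z1 yz i.
have nE : `|x 0 i| = `|y 0 i|.
  by apply: (powR_injective p0); rewrite ?nnegrE// Ex2 Ey2.
have [zi0|zi_neq0] := eqVneq (z 0 i) 0.
  have : `|x 0 i| `^ p = 0 by rewrite Ex2 zi0 normr0 powR0 ?gt_eqF.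
  move=> /powR_eq0_eq0 x0; move: (nE); rewrite x0 => /esym/normr0_eq0 ->.
  exact/normr0_eq0.
by apply: (mulIf zi_neq0); rewrite Ex1 Ey1 nE.
Qed.

Lemma hoelder_dotp x y : dotp x y <= vnorm p%:E x * vnorm q%:E y.
Proof.
have [->|x0] := eqVneq x 0.
  by rewrite -(scale0r (0 : 'rV[R]_n)) dotpZl vnormZ// normr0 !mul0r.
have [->|y0] := eqVneq y 0.
  by rewrite -(scale0r (0 : 'rV[R]_n)) dotpZr vnormZ// normr0 !mul0r mulr0.
have xn : vnorm p%:E x != 0 by rewrite vnorm_eq0.
have yn : vnorm q%:E y != 0 by rewrite vnorm_eq0.
have := dotp_unit (vnorm_normalize p0 x0) (vnorm_normalize q0 y0).
rewrite dotpZl dotpZr mulrA -invfM mulrC ler_pdivrMr ?mul1r//; last first.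
  apply: mulr_gt0; apply: vnorm_gt0; assumption.
Qed.

Lemma dual_vector x : x != 0 ->
  exists2 y, vnorm q%:E y = 1 & dotp x y = vnorm p%:E x.
Proof.
suff H z : vnorm p%:E z = 1 -> exists2 y, vnorm q%:E y = 1 & dotp z y = 1.
  move=> x0; have xn : vnorm p%:E x != 0 by rewrite vnorm_eq0.
  have [|y y1 xy] := H ((vnorm p%:E x)^-1 *: x).
    exact: vnorm_normalize.
  exists y => //; rewrite dotpZl in xy.
  by rewrite -[RHS]mulr1 -xy mulrA divff// mul1r.
move=> z1; have S1 : \sum_i `|z 0 i| `^ p = 1 by rewrite -vnormK// z1 powR1.
have qp : (p - 1) * q = p.
  have : (p^-1 + q^-1) * (p * q) = p * q by rewrite pq mul1r.
  rewrite mulrDl mulrA mulVf ?gt_eqF// mul1r mulrCA mulVf ?gt_eqF// mulr1 => E.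
  by rewrite mulrBl mul1r -E; ring.
have p1 : 0 < p - 1 by rewrite -(pmulr_lgt0 _ q0) qp.
(* The duality map of the p-norm; its value has q-norm 1 because (p - 1) q = p. *)
exists (\row_i (Num.sg (z 0 i) * `|z 0 i| `^ (p - 1))).
  rewrite vnormE (eq_bigr (fun i => `|z 0 i| `^ p)) ?S1 ?powR1// => i _.
  rewrite mxE normrM normr_sg; have [->|zn] := eqVneq (z 0 i) 0.
    by rewrite mul0r normr0 !powR0 ?gt_eqF.
  by rewrite mul1r ger0_norm ?powR_ge0// -powRrM qp.
rewrite -[RHS]S1; apply: eq_bigr => i _; rewrite mxE mulrA (mulrC (z 0 i)) -normrEsg.
refine (mulr_powRB1 (normr_ge0 _) p0).
Qed.

End Conjugate.

Definition conj_exp p : R := p / (p - 1).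

Lemma conj_expE p : 1 < p -> hoelder_conjugate p%:E = (conj_exp p)%:E.
Proof.
move=> p1; rewrite /hoelder_conjugate/= eqe gt_eqF ?(lt_trans ltr01)//.
by rewrite inver subr_eq0 gt_eqF.
Qed.

Lemma conj_exp_gt0 p : 1 < p -> 0 < conj_exp p.
Proof. by move=> p1; rewrite divr_gt0 ?subr_gt0// (lt_trans ltr01). Qed.

Lemma conj_expP p : 1 < p -> p^-1 + (conj_exp p)^-1 = 1.
Proof.
move=> p1; have p0 : p != 0 by rewrite gt_eqF// (lt_trans ltr01).
by rewrite invf_div -[X in X + _]mul1r -mulrDl addrC subrK divff.
Qed.

Section StrictlyConvexNorm.
Variables (p : R).
Hypothesis (p1 : 1 < p).
Let p0 : 0 < p := lt_trans ltr01 p1.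
Let q := conj_exp p.
Let q0 : 0 < q := conj_exp_gt0 p1.
Let pq := conj_expP p1.
Notation N := (vnorm p%:E).

Lemma vnormD x y : N (x + y) <= N x + N y.
Proof.
have [->|z0] := eqVneq (x + y) 0; first by rewrite vnorm0// addr_ge0 ?vnorm_ge0.
have [d d1 <-] := dual_vector p0 q0 pq z0.
by rewrite dotpDl lerD// (le_trans (hoelder_dotp p0 q0 pq _ _))// d1 mulr1.
Qed.

(** A unit functional that norms x + y must norm x and y as well, so the normalised vectors agree by
    [dotp_unit_inj]. The product form of the conclusion includes x = 0 and y = 0. *)
Lemma vnormD_eq x y : N (x + y) = N x + N y -> N y *: x = N x *: y.
Proof.
move=> E; have [->|xn0] := eqVneq x 0; first by rewrite vnorm0// scaler0 scale0r.
have [->|yn0] := eqVneq y 0; first by rewrite vnorm0// scaler0 scale0r.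
have nx := vnorm_gt0 p0 xn0.
have ny := vnorm_gt0 p0 yn0.
have nxn := lt0r_neq0 nx; have nyn := lt0r_neq0 ny.
have z0 : x + y != 0 by rewrite -(vnorm_eq0 _ p0) E (gt_eqF (addr_gt0 nx ny)).
have [d d1 dz] := dual_vector p0 q0 pq z0.
have dx : dotp x d <= N x.
  by move: (hoelder_dotp p0 q0 pq x d); rewrite d1 mulr1; apply.
have dy : dotp y d <= N y.
  by move: (hoelder_dotp p0 q0 pq y d); rewrite d1 mulr1; apply.
rewrite dotpDl E in dz.
have [dxE dyE] := le_addr_eq dx dy dz.
have x1 := vnorm_normalize p0 xn0; have y1 := vnorm_normalize p0 yn0.
have xd : dotp ((N x)^-1 *: x) d = 1 by rewrite dotpZl dxE (mulVf nxn).
have yd : dotp ((N y)^-1 *: y) d = 1 by rewrite dotpZl dyE (mulVf nyn).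
exact: scalerV_inj nxn nyn (dotp_unit_inj p0 q0 pq x1 y1 d1 xd yd).
Qed.

End StrictlyConvexNorm.
End VectorNorm.

(** * C^1 ramps *)

Section Ramp.
Context {R : realType}.
Implicit Types x y z h t : R.

Definition pospart z : R := (z + `|z|) / 2.

(** Half the square of the positive part, in a form without case distinction. *)
Definition pospart_prim z : R := z * (z + `|z|) / 4.

Lemma continuous_pospart : continuous pospart.
Proof.
move=> z; apply: cvgMl; apply: cvgD; first exact: cvg_id.
exact: norm_continuous.
Qed.

Lemma is_derive_pospart_prim z : is_derive z 1 pospart_prim (pospart z).
Proof.
have [z0|z0|->] := ltrgtP z 0.
- apply: (@near_eq_is_derive _ _ _ (cst 0)).
    near=> x; rewrite /pospart_prim/= ltr0_norm ?subrr ?mulr0 ?mul0r//.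
    by near: x; exact: lt_nbhsl.
  by apply: is_derive_eq; rewrite /pospart ltr0_norm// subrr mul0r.
- apply: (@near_eq_is_derive _ _ _ (fun x => x * x / 2)).
    near=> x; rewrite /pospart_prim/= gtr0_norm; last first.
      by near: x; exact: lt_nbhsr.
    by field.
  by apply: is_derive_eq; rewrite /pospart gtr0_norm// /GRing.scale/=; field.
(* At 0 the difference quotient is (x + |x|) / 4, which is already continuous. *)
- apply/is_derive1_caratheodory; exists (fun x => (x + `|x|) / 4); split.
  + by move=> x; rewrite /pospart_prim normr0; field.
  + apply: cvgMl; apply: cvgD; first exact: cvg_id.
    exact: norm_continuous.
  + by rewrite /pospart normr0 addr0 !mul0r.
Unshelve. all: by end_near. Qed.

(** A C^1 transition from 0 to 1: the antiderivative of the tent [dramp], which has support [0,1],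
    peak 2 at 1/2 and area 1. *)
Definition ramp z : R :=
  4 * (pospart_prim z - 2 * pospart_prim (z - 2^-1) + pospart_prim (z - 1)).

Definition dramp z : R :=
  4 * (pospart z - 2 * pospart (z - 2^-1) + pospart (z - 1)).

Lemma is_derive_ramp z : is_derive z 1 ramp (dramp z).
Proof.
have H c : is_derive z 1 (fun t => pospart_prim (t - c)) (pospart (z - c)).
  have := @is_derive1_comp R pospart_prim (fun t => t - c) z _ 1
            (is_derive_pospart_prim (z - c)).
  rewrite mulr1; apply.
  by apply: is_derive_eq; rewrite subr0.
have H0 := is_derive_pospart_prim z.
have H1 := H 2^-1; have H2 := H 1.
by apply: is_derive_eq; rewrite /dramp /GRing.scale/=; ring.
Qed.

Lemma continuous_dramp : continuous dramp.
Proof.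
have H c : continuous (fun t => pospart (t - c)).
  move=> z; apply: (@continuous_comp R R R (fun t => t - c) pospart); last first.
    exact: continuous_pospart.
  by apply: cvgB; [exact: cvg_id|exact: cvg_cst].
move=> z; apply: cvgMr; apply: cvgD; last exact: H.
apply: cvgB; first exact: continuous_pospart.
by apply: cvgMr; exact: H.
Qed.

Lemma pospartE z : pospart z = if 0 <= z then z else 0.
Proof.
rewrite /pospart; case: ifPn => z0; first by rewrite ger0_norm//; field.
by rewrite ltr0_norm ?ltNge// subrr mul0r.
Qed.

Lemma pospart_primE z : pospart_prim z = if 0 <= z then z ^+ 2 / 2 else 0.
Proof.
rewrite /pospart_prim; case: ifPn => z0; first by rewrite ger0_norm//; field.
by rewrite ltr0_norm ?ltNge// subrr mulr0 mul0r.
Qed.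

Lemma dramp_ge0 z : 0 <= dramp z.
Proof.
rewrite /dramp !pospartE.
by case: (lerP 0 z); case: (lerP 0 (z - 2^-1)); case: (lerP 0 (z - 1)); lra.
Qed.

Lemma dramp_le2 z : dramp z <= 2.
Proof.
rewrite /dramp !pospartE.
by case: (lerP 0 z); case: (lerP 0 (z - 2^-1)); case: (lerP 0 (z - 1)); lra.
Qed.

Lemma dramp_out z : z <= 0 \/ 1 <= z -> dramp z = 0.
Proof.
rewrite /dramp !pospartE => -[] zE;
by case: (lerP 0 z); case: (lerP 0 (z - 2^-1)); case: (lerP 0 (z - 1)); lra.
Qed.

Lemma ramp_le0 z : z <= 0 -> ramp z = 0.
Proof.
rewrite /ramp !pospart_primE le_eqVlt => /predU1P[->|z0].
  by rewrite lexx !ifF; first lra; apply/negbTE; rewrite -ltNge; lra.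
by rewrite !ifF; first lra; apply/negbTE; rewrite -ltNge; lra.
Qed.

Lemma ramp_ge1 z : 1 <= z -> ramp z = 1.
Proof.
by move=> z1; rewrite /ramp !pospart_primE !ifT; [field|lra..].
Qed.

Lemma ramp_itv z : 0 <= ramp z <= 1.
Proof.
have [z0|z0] := lerP z 0; first by rewrite ramp_le0// lexx ler01.
have [z1|z1] := lerP 1 z; first by rewrite ramp_ge1// ler01 lexx.
rewrite /ramp !pospart_primE ifT; last lra.
rewrite [X in _ + X]ifF; last by apply/negbTE; rewrite -ltNge; lra.
by case: (lerP 0 (z - 2^-1)) => z2; apply/andP; split; nra.
Qed.

Lemma Rintegral_derive1 (g : R -> R) a b : a <= b ->
  (forall t, derivable g t 1) -> continuous (derive1 g) ->
  \int[lebesgue_measure]_(t in `]a, b[%classic) derive1 g t = g b - g a.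
Proof.
rewrite le_eqVlt => /predU1P[-> _ _|ab dg cg].
  by rewrite set_itvoo0 Rintegral_set0 subrr.
rewrite /Rintegral -(@integral_itv_bndoo _ _ _ _ true false); last first.
  apply/measurable_EFinP; apply: measurable_funTS.
  exact: continuous_measurable_fun.
have cg' : continuous g.
  by move=> x; apply/differentiable_continuous/derivable1_diffP.
suff -> : (\int[lebesgue_measure]_(t in `[a, b]%classic) (derive1 g t)%:E =
           (g b)%:E - (g a)%:E)%E by [].
apply: (continuous_FTC2 ab) => [||x _]; [exact: continuous_subspaceT| |by []].
split; first by move=> x _; exact: dg.
- exact/cvg_at_right_filter/cg'.
- exact/cvg_at_left_filter/cg'.
Qed.

End Ramp.

(** * Test functions *)

Section Pairing.
Context {R : realType} {M : nat}.
Notation mu := (@lebesgue_measure R).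
Implicit Types (u w phi psi : R -> 'rV[R]_M) (T x y : R).

Definition pairing T u phi : R :=
  \int[mu]_(t in `]0, T[%classic)
    \sum_i u t 0 i * derive1 (fun x => phi x 0 i) t.

Definition admissible (p : \bar R) T phi : Prop :=
  C1c T phi /\
  forall t, t \in `]0, T[ -> vnorm (hoelder_conjugate p) (phi t) <= 1.

Lemma TV_ge (p : \bar R) T u phi :
  admissible p T phi -> ((pairing T u phi)%:E <= TV T p u)%E.
Proof. move=> Hphi; apply: ereal_sup_ubound. by exists phi. Qed.

Lemma TV_le (p : \bar R) T u (c : \bar R) :
  (forall phi, admissible p T phi -> ((pairing T u phi)%:E <= c)%E) ->
  (TV T p u <= c)%E.
Proof. by move=> H; apply: ge_ereal_sup => _ [phi /H Hphi <-]. Qed.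

Lemma bounded_continuous_itv (h : R -> R) a b :
  continuous h -> [bounded h x | x in `]a, b[%classic].
Proof.
move=> ch; have := @continuous_compact _ _ h `[a, b]%classic
  (continuous_subspaceT ch) (segment_compact (a := a) (b := b)).
move=> /compact_bounded [c [cr hc]]; exists c; split=> // d cd x /=.
move=> /subset_itv_oo_cc xab; apply: hc cd _ _.
by exists x.
Qed.

Lemma integrable_mul_continuous (f h : R -> R) (D : set R) a b :
  measurable D -> D `<=` `]a, b[%classic ->
  mu.-integrable D (EFin \o f) -> continuous h ->
  mu.-integrable D (EFin \o (fun t => f t * h t)).
Proof.
move=> mD Dab fi ch.
have [c [cr hc]] := bounded_continuous_itv a b ch.
rewrite (_ : _ \o _ = (EFin \o f) \* (EFin \o h))%E; last first.
  by apply/funext => t /=; rewrite EFinM.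
apply: integrableMl => //.
  by apply: measurable_funTS; exact: continuous_measurable_fun.
by exists c; split=> // d cd x /Dab; exact: hc.
Qed.

Lemma C1c_integrable T u phi i : inL1 T u -> C1c T phi ->
  mu.-integrable `]0, T[%classic
    (EFin \o (fun t => u t 0 i * derive1 (fun x => phi x 0 i) t)).
Proof.
move=> uL [_ cphi _ _].
apply: (@integrable_mul_continuous _ _ _ 0 T) => //; exact: uL.
Qed.

Lemma Rintegral_sum n (D : set R) (f : 'I_n -> R -> R) : measurable D ->
  (forall i, mu.-integrable D (EFin \o f i)) ->
  \int[mu]_(t in D) \sum_i f i t = \sum_i \int[mu]_(t in D) f i t.
Proof.
move=> mD fi; rewrite /Rintegral.
under eq_integral do rewrite -sumEFin.
rewrite (@integral_sum _ _ R mu D mD _ (fun i t => (f i t)%:E) fi).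
rewrite (eq_bigr (fun i => (fine (\int[mu]_(t in D) (f i t)%:E)%E)%:E)).
  by rewrite sumEFin.
by move=> i _; rewrite fineK//; apply: integrable_fin_num => //; exact: fi.
Qed.

Lemma pairingE T u phi : inL1 T u -> C1c T phi ->
  pairing T u phi = \sum_i \int[mu]_(t in `]0, T[%classic)
    (u t 0 i * derive1 (fun x => phi x 0 i) t).
Proof.
move=> uL cphi; apply: Rintegral_sum => // i.
exact: C1c_integrable.
Qed.

Lemma C1cP T (K : set R) phi : compact K -> K `<=` `]0, T[%classic ->
  (forall i t, derivable (fun x => phi x 0 i) t 1) ->
  (forall i, continuous (derive1 (fun x => phi x 0 i))) ->
  (forall t, ~ K t -> phi t = 0) -> C1c T phi.
Proof.
move=> cK KT dphi cphi phi0.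
have clK : closure [set t | phi t != 0] `<=` K.
  rewrite closureE; apply: smallest_sub.
    by apply: compact_closed => //; exact: Rhausdorff.
  by move=> t /= phit; apply: contrapT => /phi0 E; rewrite E eqxx in phit.
split; [exact: dphi|exact: cphi| |exact: subset_trans KT].
by apply: subclosed_compact clK => //; exact: closed_closure.
Qed.

Lemma C1c_widen x y phi : x <= y -> C1c x phi -> C1c y phi.
Proof.
move=> xy [d c K sub]; split=> //; apply: subset_trans sub _.
by apply: subset_itvl; rewrite bnd_simp.
Qed.

(** The complement of the closed support is a neighbourhood of such a point, so the function
    vanishes near it and its derivative with it. This makes extension by zero to larger intervals
    harmless. *)
Lemma C1c_out T phi t : C1c T phi -> t \notin `]0, T[ ->
  phi t = 0 /\ forall i, derive1 (fun x => phi x 0 i) t = 0.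
Proof.
move=> [_ _ _ sub] tT.
have tcl : ~ closure [set t | phi t != 0] t by move=> /sub; exact/negP.
have nearphi : \forall s \near t, phi s = 0.
  have : nbhs t (~` closure [set t | phi t != 0]).
    by apply: open_nbhs_nbhs; split=> //; exact/closed_openC/closed_closure.
  apply: filterS => s ns; apply: contrapT => /eqP phis; apply: ns.
  exact: subset_closure.
split; first exact: (nbhs_singleton nearphi).
move=> i; rewrite derive1E.
rewrite (@near_eq_derive _ _ _ _ (cst 0)) ?derive_cst//.
by apply: filterS nearphi => s ->; rewrite mxE.
Qed.

Lemma pairing_widen x y u phi : x <= y -> C1c x phi ->
  pairing y u phi = pairing x u phi.
Proof.
move=> xy cphi.
have -> : pairing x u phi = \int[mu]_(t in `]0, y[%classic `&` `]0, x[%classic)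
    \sum_i u t 0 i * derive1 (fun x => phi x 0 i) t.
  rewrite setIidr//; apply: subset_itvl; rewrite bnd_simp//.
rewrite Rintegral_mkcondr; apply: eq_Rintegral => t _; rewrite patchE.
case: ifPn => // tx; rewrite big1// => i _.
have [|_ ->] := C1c_out (t := t) cphi; last by rewrite mulr0.
by rewrite mem_setE in tx.
Qed.

Lemma C1cD T phi psi : C1c T phi -> C1c T psi -> C1c T (phi + psi).
Proof.
move=> [d c K sub] [d' c' K' sub'].
have E i : (fun x => (phi + psi) x 0 i) = (fun x => phi x 0 i) \+ (fun x => psi x 0 i).
  by apply/funext => x; rewrite !mxE.
apply: (@C1cP T (closure [set t | phi t != 0] `|` closure [set t | psi t != 0])).
- exact: compactU.
- by rewrite subUset.
- by move=> i t; rewrite E; apply: derivableD.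
- move=> i; rewrite E (_ : derive1 _ =
    derive1 (fun x => phi x 0 i) \+ derive1 (fun x => psi x 0 i)).
    by move=> t; apply: cvgD; [exact: c|exact: c'].
  by apply/funext => t; rewrite /= !derive1E deriveD.
- move=> t /not_orP[nphi npsi].
  suff H f : ~ closure [set t | f t != 0] t -> f t = 0 :> 'rV[R]_M.
    by rewrite -[LHS]/(phi t + psi t) !H// addr0.
  move=> nf; apply: contrapT => /eqP ft; apply: nf.
  exact: subset_closure.
Qed.

Lemma pairingD T u phi psi : inL1 T u -> C1c T phi -> C1c T psi ->
  pairing T u (phi + psi) = pairing T u phi + pairing T u psi.
Proof.
move=> uL cphi cpsi; rewrite !pairingE//; last exact: C1cD.
rewrite -big_split; apply: eq_bigr => i _.
refine (etrans _ (RintegralD _ (C1c_integrable i uL cphi)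
  (C1c_integrable i uL cpsi))); last by [].
apply: eq_Rintegral => t _; rewrite -mulrDr; congr (_ * _).
have [d _ _ _] := cphi; have [d' _ _ _] := cpsi.
rewrite (_ : (fun x => (phi + psi) x 0 i) =
  (fun x => phi x 0 i) \+ (fun x => psi x 0 i)) ?derive1E ?deriveD//.
by apply/funext => x; rewrite !mxE.
Qed.

Lemma C1c0 T : C1c T (0 : R -> 'rV[R]_M).
Proof.
have E i : (fun x : R => (0 : R -> 'rV[R]_M) x 0 i) = cst 0.
  by apply/funext => x; rewrite mxE.
apply: (@C1cP _ set0) => //.
- exact: compact0.
- by move=> i t; rewrite E; exact: derivable_cst.
- move=> i; rewrite E (_ : derive1 _ = cst 0); first by move=> x; exact: cvg_cst.
  by apply/funext => x; rewrite derive1_cst.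
Qed.

Lemma pairing0 T u : inL1 T u -> pairing T u 0 = 0.
Proof.
move=> uL; have := pairingD uL (C1c0 T) (C1c0 T).
by rewrite addr0 => /eqP; rewrite -subr_eq subrr => /eqP.
Qed.

End Pairing.

(** * Weighted averages at Lebesgue points *)

Section LebesgueAverage.
Context {R : realType}.
Notation mu := (@lebesgue_measure R).

Lemma integrable_cst_itv (c a b : R) :
  mu.-integrable `]a, b[%classic (EFin \o cst c).
Proof.
have ci : mu.-integrable `[a, b]%classic (EFin \o cst c).
  apply: continuous_compact_integrable; first exact: segment_compact.
  by apply: continuous_subspaceT => x; exact: cvg_cst.
by apply: integrableS ci => //; exact: subset_itv_oo_cc.
Qed.

(* The kernels [k] concentrate at [x] without being centred there. *)
Lemma lebesgue_pt_average (f : R -> R) (x e : R) : 0 < e ->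
  mu.-integrable setT (EFin \o f) -> lebesgue_pt f x ->
  exists2 h0 : R, 0 < h0 & forall (h : R) (k : R -> R) (a b : R), 0 < h < h0 ->
    continuous k -> (forall t, 0 <= k t <= 2 / h) ->
    (forall t, ~ ball x (3 * h) t -> k t = 0) ->
    \int[mu]_(t in `]a, b[%classic) k t = 1 ->
    `|\int[mu]_(t in `]a, b[%classic) (f t * k t) - f x| <= e.
Proof.
(* The kernel is at most 2 / h and the ball of radius 3 h has length 6 h: together they cost a
   factor 12 over the mean deviation. *)
move=> e0 fi /fine_cvgP [finf /cvgrPdist_lt/(_ (e / 12))].
rewrite divr_gt0// => /(_ isT) cvgf.
have [d d0 Hd] : exists2 d : R, 0 < d & forall r, 0 < r < d ->
    davg f x r \is a fin_num /\ `|0 - fine (davg f x r)| < e / 12.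
  case: (filterI finf cvgf) => d /= d0 Hd; exists d => // r /andP[r0 rd].
  apply: Hd => //; rewrite /ball_/= sub0r normrN gtr0_norm//.
exists (d / 3); first by rewrite divr_gt0.
move=> h k a b /andP[h0 hd] ck kb kout k1.
set D := `]a, b[%classic.
have mD : measurable D by exact: measurable_itv.
have fD : mu.-integrable D (EFin \o f) by exact: integrableS fi.
have c1 : mu.-integrable D (EFin \o cst (f x)).
  exact: integrable_cst_itv.
pose g t := f t - f x.
have gi : mu.-integrable D (EFin \o g).
  rewrite (_ : _ \o _ = (EFin \o f) \- (EFin \o cst (f x)))%E.
    exact: integrableB.
  by apply/funext => t.
have intk (u : R -> R) : mu.-integrable D (EFin \o u) ->
    mu.-integrable D (EFin \o (fun t => u t * k t)).
  by move=> ui; apply: (@integrable_mul_continuous _ _ _ _ a b).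
have -> : \int[mu]_(t in D) (f t * k t) - f x = \int[mu]_(t in D) (g t * k t).
  rewrite -[X in _ - X]mulr1 -k1 -RintegralZl//; last first.
    apply: eq_integrable (intk (cst 1) _) => //.
      by move=> t _; rewrite /= mul1r.
    exact: integrable_cst_itv.
  refine (etrans (esym (RintegralB _ (intk _ fD) (intk _ c1))) _) => //.
  by apply: eq_Rintegral => t _; rewrite /g mulrBl.
have gki := intk _ gi.
have [h3 hl] : 0 < 3 * h < d /\ 0 < 3 * h.
  by split; [apply/andP; split|]; lra.
have [davgfin] := Hd _ h3; rewrite sub0r normrN => /(le_lt_trans (ler_norm _)) davglt.
have mB : measurable (ball x (3 * h)) by exact: measurable_ball.
have mg : measurable_fun setT (fun t => `|g t|%:E).
  apply/measurable_EFinP/measurableT_comp => //.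
  apply: measurable_funB => //; apply/measurable_EFinP.
  exact: measurable_int fi.
rewrite -lee_fin EFin_normr_Rintegral//.
apply: (le_trans (le_abse_integral _ _ _)) => //.
  exact: measurable_int gki.
apply: (@le_trans _ _ ((2 / h)%:E * \int[mu]_(t in ball x (3 * h)) `|g t|%:E)%E).
  rewrite -ge0_integralZl_EFin//; last 2 first.
    exact: measurable_funTS mg.
    by rewrite divr_ge0// ltW.
  rewrite integral_mkcond [leRHS]integral_mkcond; apply: ge0_le_integral => //.
  - by move=> t _; rewrite patchE; case: ifP.
  - apply/(measurable_restrictT _ mD); apply: measurableT_comp => //.
    exact: measurable_int gki.
  - apply/(measurable_restrictT _ mB); apply: measurable_funTS.
    exact: measurable_funeM.
  - move=> t _; rewrite !patchE; case: ifPn => tD; last first.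
      by case: ifP => // _; rewrite -EFinM lee_fin mulr_ge0// divr_ge0// ltW.
    have /andP[k0 kh] := kb t.
    case: ifPn => tB.
      rewrite -EFinM lee_fin normrM mulrC (ger0_norm k0).
      by rewrite ler_wpM2r.
    have k0t : k t = 0 by apply: kout => tb; move: tB; rewrite mem_set.
    by rewrite k0t mulr0 abse0.
have /fineK dE := davgfin.
have intE : (\int[mu]_(t in ball x (3 * h)) `|g t|%:E =
    ((3 * h) *+ 2)%:E * davg f x (3 * h))%E.
  rewrite /davg /iavg lebesgue_measure_ball; last exact: ltW.
  rewrite inver mulrn_eq0/= gt_eqF// muleA -EFinM divff ?mul1e//.
  by rewrite mulrn_eq0/= gt_eqF.
rewrite intE -dE -EFinM lee_fin mulrA.
have -> : 2 / h * (3 * h *+ 2) = 12 by rewrite -mulr_natr; field; exact: lt0r_neq0.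
by rewrite -ler_pdivlMl// (mulrC _ e) ltW.
Qed.

End LebesgueAverage.

(** * Scaled tents as one-sided averaging kernels *)

Section Kernel.
Context {R : realType}.
Notation mu := (@lebesgue_measure R).
Implicit Types c h t a b : R.

Definition kernel c h t : R := dramp ((t - c) / h) / h.

Lemma is_derive_scaled_ramp c h t :
  is_derive t 1 (fun s => ramp ((s - c) / h)) (kernel c h t).
Proof.
have H := @is_derive1_comp R ramp (fun s => (s - c) / h) t _ h^-1
            (is_derive_ramp ((t - c) / h)).
apply: H; have -> : (fun s => (s - c) / h) = h^-1 *: (id - cst c).
  by apply/funext => s; rewrite mulrC.
by apply: is_derive_eq; rewrite subr0 /GRing.scale/= mulr1.
Qed.

Lemma continuous_kernel c h : continuous (kernel c h).
Proof.
move=> t; apply: cvgMl.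
apply: (@continuous_comp R R R (fun t => (t - c) / h) dramp); last first.
  exact: continuous_dramp.
by apply: cvgMl; apply: cvgB; [exact: cvg_id|exact: cvg_cst].
Qed.

Lemma kernel_itv c h t : 0 < h -> 0 <= kernel c h t <= 2 / h.
Proof.
move=> h0; apply/andP; split; first exact: divr_ge0 (dramp_ge0 _) (ltW h0).
by rewrite /kernel ler_pM2r ?invr_gt0// dramp_le2.
Qed.

Lemma kernel_out c h t : 0 < h -> t <= c \/ c + h <= t -> kernel c h t = 0.
Proof.
move=> h0 tc; rewrite /kernel dramp_out ?mul0r//.
case: tc => tc; [left|right].
  by rewrite ler_pdivrMr// mul0r subr_le0.
by rewrite ler_pdivlMr// mul1r lerBrDl.
Qed.

Lemma Rintegral_kernel c h a b : 0 < h -> a <= c -> c + h <= b ->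
  \int[mu]_(t in `]a, b[%classic) kernel c h t = 1.
Proof.
move=> h0 ac cb; pose g s := ramp ((s - c) / h).
have dg : derive1 g = kernel c h.
  apply/funext => t; rewrite derive1E.
  by have /@derive_val := is_derive_scaled_ramp c h t.
rewrite -dg Rintegral_derive1.
- rewrite /g ramp_ge1 ?ramp_le0 ?subr0//.
    by rewrite ler_pdivrMr// mul0r subr_le0.
  by rewrite ler_pdivlMr// mul1r lerBrDl.
- by rewrite (le_trans ac)// (le_trans _ cb)// lerDl ltW.
- by move=> t; have /@ex_derive := is_derive_scaled_ramp c h t.
- by rewrite dg; exact: continuous_kernel.
Qed.

End Kernel.

(** * Test functions that measure the increment between two points *)

Section Increments.
Context {R : realType} {M : nat}.
Notation mu := (@lebesgue_measure R).
Implicit Types (u w phi psi : R -> 'rV[R]_M) (T x y h t : R) (d : 'rV[R]_M).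

(** Lebesgue differentiation is applied on the whole line, hence the extension by zero; near points
    of (0,T) nothing changes. *)
Definition cut T w i : R -> R := (fun t => w t 0 i) \_ `]0, T[%classic.

Definition interior_lebesgue_pt T w x : Prop :=
  (x \in `]0, T[) /\ forall i, lebesgue_pt (cut T w i) x.

Lemma inL1_le x T w : x <= T -> inL1 T w -> inL1 x w.
Proof.
move=> xT wL i; apply: integrableS (wL i) => //.
by apply: subset_itvl; rewrite bnd_simp.
Qed.

Lemma integrable_cut T w i : inL1 T w -> mu.-integrable setT (EFin \o cut T w i).
Proof.
move=> wL; rewrite /cut -restrict_EFin; apply/integrable_restrict => //.
by rewrite setTI; exact: wL.
Qed.

Lemma cutE T w i t : t \in `]0, T[ -> cut T w i t = w t 0 i.
Proof. by move=> tT; rewrite /cut patchE mem_setE tT. Qed.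

Lemma admissible_widen (p : R) x y phi : 1 < p -> x <= y ->
  admissible p%:E x phi -> admissible p%:E y phi.
Proof.
move=> p1 xy [cphi nphi]; split; first exact: C1c_widen cphi.
move=> t _; have [|tx] := boolP (t \in `]0, x[); first exact: nphi.
have [-> _] := C1c_out cphi tx.
by rewrite (conj_expE p1) vnorm0 ?ler01// conj_exp_gt0.
Qed.

Lemma TV_mono (p : R) x y w : 1 < p -> x <= y ->
  (TV x p%:E w <= TV y p%:E w)%E.
Proof.
move=> p1 xy; apply: TV_le => phi aphi.
rewrite -(pairing_widen w xy (proj1 aphi)); apply: TV_ge.
exact: admissible_widen aphi.
Qed.

Lemma TV_ge0 (p : R) x w : 1 < p -> inL1 x w -> (0 <= TV x p%:E w)%E.
Proof.
move=> p1 wL; have <- : ((pairing x w 0)%:E = 0)%E by rewrite pairing0.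
apply: TV_ge; split; first exact: C1c0.
by move=> t _; rewrite (conj_expE p1) vnorm0 ?ler01// conj_exp_gt0.
Qed.

(** For 0 < 3 h <= y - x the coefficient of [d] goes from 0 to -1 on [x, x + h] and back to 0 on
    [y - 2 h, y - h]. With this sign, pairing with the derivative gives an average of [w] near [y]
    minus one near [x]. Stopping at y - h keeps the support compact in (0,y). *)
Definition bump x y h (d : 'rV[R]_M) : R -> 'rV[R]_M :=
  fun t => (ramp ((t - (y - 2 * h)) / h) - ramp ((t - x) / h)) *: d.

Lemma bumpE x y h d i : (fun t => bump x y h d t 0 i) =
  (fun t => (ramp ((t - (y - 2 * h)) / h) - ramp ((t - x) / h)) * d 0 i).
Proof. by apply/funext => t; rewrite mxE. Qed.

Lemma is_derive_bump x y h d i t : is_derive t (1 : R) (fun t => bump x y h d t 0 i)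
  ((kernel (y - 2 * h) h t - kernel x h t) * d 0 i).
Proof.
rewrite bumpE; have H1 := is_derive_scaled_ramp x h t.
have H2 := is_derive_scaled_ramp (y - 2 * h) h t.
rewrite (_ : (fun _ => _) = d 0 i *: ((fun t => ramp ((t - (y - 2 * h)) / h)) -
  (fun t => ramp ((t - x) / h)))); last by apply/funext => s; rewrite mulrC.
by apply: is_derive_eq; rewrite /GRing.scale/= mulrC.
Qed.

Lemma derive1_bump x y h d i : derive1 (fun t => bump x y h d t 0 i) =
  (fun t => (kernel (y - 2 * h) h t - kernel x h t) * d 0 i).
Proof.
apply/funext => t; rewrite derive1E.
by have /@derive_val := is_derive_bump x y h d i t.
Qed.

Section BumpSupport.
Variables (x y h : R) (d : 'rV[R]_M).
Hypotheses (x0 : 0 < x) (h0 : 0 < h) (hxy : 3 * h <= y - x).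

Lemma bump_out t : ~ (t \in `[x, y - h]) -> bump x y h d t = 0.
Proof.
move: (x0) (h0) (hxy) => x1 h1 hxy1.
rewrite in_itv/= => /negP; rewrite negb_and -!ltNge => /orP[tx|yt].
  have {}tx : t < x := tx.
  have t1 : t - x <= 0 by rewrite subr_le0 ltW.
  have t2 : t - (y - 2 * h) <= 0 by lra.
  rewrite /bump !ramp_le0 ?subrr ?scale0r//.
    by rewrite ler_pdivrMr// mul0r.
  by rewrite ler_pdivrMr// mul0r.
have {}yt : y - h < t := yt.
rewrite /bump !ramp_ge1 ?subrr ?scale0r//.
  by rewrite ler_pdivlMr// mul1r; lra.
by rewrite ler_pdivlMr// mul1r; lra.
Qed.

Lemma C1c_bump : C1c y (bump x y h d).
Proof.
move: (x0) (h0) (hxy) => x1 h1 hxy1.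
apply: (@C1cP _ _ _ `[x, y - h]%classic).
- exact: segment_compact.
- by move=> t /=; rewrite !in_itv/= => /andP[xt ty]; apply/andP; split; lra.
- by move=> i t; have /@ex_derive := is_derive_bump x y h d i t.
- move=> i t; rewrite derive1_bump; apply: cvgMl.
  by apply: cvgB; exact: continuous_kernel.
- by move=> t /= ty; exact: bump_out.
Qed.

Lemma vnorm_bump_le (q : R) t : 0 < q ->
  vnorm q%:E (bump x y h d t) <= vnorm q%:E d.
Proof.
move=> q0; rewrite vnormZ// -[leRHS]mul1r; apply: ler_wpM2r; first exact: vnorm_ge0.
have /andP[a0 a1] := ramp_itv ((t - (y - 2 * h)) / h).
have /andP[b0 b1] := ramp_itv ((t - x) / h).
by rewrite ler_norml; apply/andP; split; lra.
Qed.

Lemma pairing_bump w : inL1 y w -> pairing y w (bump x y h d) =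
  \sum_i (\int[mu]_(t in `]0, y[%classic) (w t 0 i * kernel (y - 2 * h) h t) -
     \int[mu]_(t in `]0, y[%classic) (w t 0 i * kernel x h t)) * d 0 i.
Proof.
move=> wL; rewrite (pairingE wL C1c_bump); apply: eq_bigr => i _.
rewrite derive1_bump.
have ik c : mu.-integrable `]0, y[%classic
    (EFin \o (fun t => w t 0 i * kernel c h t)).
  apply: (@integrable_mul_continuous _ _ _ _ 0 y) => //; first exact: wL.
  exact: continuous_kernel.
have <- := RintegralB _ (ik (y - 2 * h)) (ik x); last by [].
rewrite -RintegralZr//; last first.
  pose f c := EFin \o (fun t => w t 0 i * kernel c h t).
  rewrite (_ : _ \o _ = f (y - 2 * h)%R \- f x)%E; last by apply/funext.
  by apply: integrableB => //; exact: ik.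
by apply: eq_Rintegral => t _; ring.
Qed.

End BumpSupport.
End Increments.

(** * Increments of the variation *)

Section TVIncrement.
Context {R : realType} {M : nat}.
Notation mu := (@lebesgue_measure R).
Implicit Types (u w phi psi : R -> 'rV[R]_M) (T x y h t : R) (d : 'rV[R]_M).

(* [near] form of [lebesgue_pt_average]; the kernel may start at [x] or at
   [x - 2 h]. *)
Lemma near_kernel_average T y w i x c e : 0 < e -> y <= T -> inL1 T w ->
  interior_lebesgue_pt T w x -> c = 0 \/ c = 2 ->
  \forall h \near 0^'+, (0 <= x - c * h -> x - c * h + h <= y ->
    `|\int[mu]_(t in `]0, y[%classic) (w t 0 i * kernel (x - c * h) h t)
      - w x 0 i| <= e).
Proof.
move=> e0 yT wL [xT lx] c02.
have [h0 h00 H] := lebesgue_pt_average e0 (integrable_cut i wL) (lx i).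
near=> h => ch chy.
have hh : 0 < h < h0.
  by apply/andP; split; near: h; [exact: nbhs_right_gt|exact: nbhs_right_lt].
have /andP[hp _] := hh.
have := H h (kernel (x - c * h) h) 0 y hh (@continuous_kernel _ _ _)
  (fun t => kernel_itv (x - c * h) t hp) _ (Rintegral_kernel hp ch chy).
have -> : \int[mu]_(t in `]0, y[%classic) (cut T w i t * kernel (x - c * h) h t) =
    \int[mu]_(t in `]0, y[%classic) (w t 0 i * kernel (x - c * h) h t).
  apply: eq_Rintegral => t; rewrite inE/= => ty; rewrite cutE//.
  by move: ty; rewrite !in_itv/= => /andP[-> /lt_le_trans ->].
rewrite (cutE _ _ xT).
apply=> t; rewrite /ball/= => xt; apply: kernel_out => //.
have [|tc] := lerP t (x - c * h); first by left.
right; rewrite leNgt; apply/negP => tch; apply: xt.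
(* The kernel lives on [x, x + h] or on [x - 2 h, x - h], both inside the open ball of radius 3
   h. *)
by rewrite ltr_norml; case: c02 tc tch => -> tc tch; apply/andP; split; lra.
Unshelve. all: by end_near. Qed.

Lemma bump_room x y h : 0 < x -> 0 < h -> 3 * h <= y - x ->
  [/\ 0 <= y - 2 * h, y - 2 * h + h <= y & x + h <= y].
Proof. by move=> x0 h0 hxy; split; lra. Qed.

Lemma distB_le (a b c d e : R) : `|a - c| <= e -> `|b - d| <= e ->
  `|(c - d) - (a - b)| <= 2 * e.
Proof.
move=> ac bd; rewrite mulr_natl mulr2n.
have -> : (c - d) - (a - b) = - (a - c) + (b - d) by ring.
by rewrite (le_trans (ler_normD _ _))// normrN lerD.
Qed.

Lemma subr_le_trans (a b c e : R) : a - b <= c -> c <= e -> a - e <= b.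
Proof. by move=> h1 h2; lra. Qed.

Lemma TV_increment (p : R) T w x y : 1 < p -> inL1 T w ->
  interior_lebesgue_pt T w x -> interior_lebesgue_pt T w y -> x < y ->
  (TV x p%:E w + (vnorm p%:E (w y - w x))%:E <= TV y p%:E w)%E.
Proof.
move=> p1 wL rx ry xy.
have p0 : 0 < p := lt_trans ltr01 p1.
have q0 := conj_exp_gt0 p1.
have x0 : 0 < x by have [] := rx; rewrite in_itv/= => /andP[].
have yT : y <= T by have [] := ry; rewrite in_itv/= => /andP[_ /ltW].
have yL := inL1_le yT wL.
have [wE|wn] := eqVneq (w y - w x) 0.
  by rewrite wE vnorm0// adde0 TV_mono// ltW.
have [d d1 dE] := dual_vector p0 q0 (conj_expP p1) wn.
rewrite -leeBrDr//; apply: TV_le => phi [cphi nphi]; rewrite leeBrDr//.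
apply/lee_addgt0Pr => e e0.
(* Each component carries two averages with error at most [e'], weighted by |d_i|; the summand 1
   keeps the denominator positive. *)
pose e' := e / (2 * (\sum_i `|d 0 i| + 1)).
have S0 : 0 <= \sum_i `|d 0 i| by exact: sumr_ge0.
have e'0 : 0 < e' by rewrite divr_gt0// mulr_gt0// ltr_wpDl.
pose P i h := `|\int[mu]_(t in `]0, y[%classic) (w t 0 i * kernel (y - 2 * h) h t)
      - w y 0 i| <= e' /\
  `|\int[mu]_(t in `]0, y[%classic) (w t 0 i * kernel x h t) - w x 0 i| <= e'.
have nearP : \forall h \near 0^'+, 3 * h <= y - x -> 0 < h -> forall i, P i h.
  have n1 : \forall h \near 0^'+, forall i, (0 <= y - 2 * h -> y - 2 * h + h <= y ->
    `|\int[mu]_(t in `]0, y[%classic) (w t 0 i * kernel (y - 2 * h) h t)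
      - w y 0 i| <= e').
    by apply: filter_forall => i; exact: (near_kernel_average i e'0 yT wL ry (or_intror erefl)).
  have n2 : \forall h \near 0^'+, forall i, (0 <= x - 0 * h -> x - 0 * h + h <= y ->
    `|\int[mu]_(t in `]0, y[%classic) (w t 0 i * kernel (x - 0 * h) h t)
      - w x 0 i| <= e').
    by apply: filter_forall => i; exact: (near_kernel_average i e'0 yT wL rx (or_introl erefl)).
  near=> h => h3 h0 i; split.
    have [l1 l2 _] := bump_room x0 h0 h3.
    exact: (near n1 h _ i l1 l2).
  have [_ _ l3] := bump_room x0 h0 h3.
  have := near n2 h _ i; rewrite mul0r subr0; apply=> //; exact: ltW.
have [h [h0 h3 Ph]] : exists h, [/\ 0 < h, 3 * h <= y - x & forall i, P i h].
  have : \forall h \near (0 : R)^'+, 0 < h /\ 3 * h <= y - x.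
    near=> h; split; first by near: h; exact: nbhs_right_gt.
    rewrite mulrC -ler_pdivlMr//; near: h; apply: nbhs_right_le.
    by rewrite divr_gt0// subr_gt0.
  move=> /(filterI nearP)/filter_ex[h [H [h0 h3]]].
  by exists h; split=> //; exact: H.
pose psi := bump x y h d.
have cpsi : C1c y psi by exact: C1c_bump.
have cphi' : C1c y phi by apply: C1c_widen cphi; exact: ltW.
have adm : admissible p%:E y (phi + psi).
  split; first exact: C1cD.
  move=> t _; rewrite (conj_expE p1) -[(phi + psi) t]/(phi t + psi t).
  (* As [phi] vanishes from [x] on, at most one of the two summands is nonzero at each point, so the
     norm constraint survives the addition. *)
  have [tK|tK] := boolP (t \in `[x, y - h]).
    have [|-> _] := C1c_out (t := t) cphi.
      by move: tK; rewrite !in_itv/= negb_and -!leNgt => /andP[-> _]; rewrite orbT.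
    by rewrite add0r -d1; apply: vnorm_bump_le.
  rewrite /psi bump_out//; last exact/negP.
  rewrite addr0 -(conj_expE p1).
  have [tx|tx] := boolP (t \in `]0, x[); first exact: nphi.
  by have [-> _] := C1c_out cphi tx; rewrite (conj_expE p1) vnorm0// ler01.
have := TV_ge w adm; rewrite (pairingD yL cphi' cpsi) (pairing_widen _ (ltW xy) cphi).
set J := pairing y w psi => HJ.
have JE : vnorm p%:E (w y - w x) - e <= J.
  rewrite /J /psi pairing_bump// -dE /dotp.
  have : \sum_i (w y - w x) 0 i * d 0 i -
     \sum_i (\int[mu]_(t in `]0, y[%classic) (w t 0 i * kernel (y - 2 * h) h t) -
     \int[mu]_(t in `]0, y[%classic) (w t 0 i * kernel x h t)) * d 0 i <=
     \sum_i (2 * e' * `|d 0 i|).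
    rewrite -sumrB; apply: ler_sum => i _; rewrite -mulrBl.
    apply: le_trans (ler_norm _) _; rewrite normrM; apply: ler_wpM2r => //.
    have [P1 P2] := Ph i; rewrite !mxE.
    exact: distB_le.
  rewrite -mulr_sumr.
  have : 2 * e' * (\sum_i `|d 0 i|) <= e.
    have -> : e = 2 * e' * (\sum_i `|d 0 i| + 1).
      by rewrite /e'; field; rewrite gt_eqF// ltr_wpDl.
    by apply: ler_wpM2l; [rewrite mulr_ge0// ltW|rewrite lerDl].
  by move=> h1 h2; exact: subr_le_trans h2 h1.
apply: (@le_trans _ _ ((pairing x w phi + J)%:E + e%:E)%E).
  by rewrite -!EFinD lee_fin -addrA lerD2l -lerBlDr.
by rewrite leeD2r.
Unshelve. all: by end_near. Qed.

Lemma lebesgue_aeS (P Q : R -> Prop) : (forall t, P t -> Q t) ->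
  {ae mu, forall t, P t} -> {ae mu, forall t, Q t}.
Proof.
by move=> PQ; apply: filterS; first exact: (ae_filter_ringOfSetsType mu).
Qed.

Lemma lebesgue_aeI (P Q : R -> Prop) :
  {ae mu, forall t, P t} -> {ae mu, forall t, Q t} ->
  {ae mu, forall t, P t /\ Q t}.
Proof.
by move=> HP HQ; exact: (@filterI _ _ (ae_filter_ringOfSetsType mu) _ _ HP HQ).
Qed.

Lemma ae_interior_lebesgue_pt T w : inL1 T w ->
  {ae mu, forall t : R, t \in `]0, T[ -> interior_lebesgue_pt T w t}.
Proof.
move=> wL.
have : {ae mu, forall t : R, forall i, lebesgue_pt (cut T w i) t}.
  apply: (@filter_forall _ _ _ _ (ae_filter_ringOfSetsType mu)) => i.
  apply: lebesgue_differentiation.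
  by apply: open_integrable_locally; [exact: openT|exact: integrable_cut].
by apply: lebesgue_aeS => t H tT; split.
Qed.

End TVIncrement.

(** * Step functions *)

Section StepFunctions.
Context {R : realType} {M m : nat}.
Notation mu := (@lebesgue_measure R).
Implicit Types (T x y : R) (t s : 'rV[R]_m) (a : 'I_m.+1 -> 'rV[R]_M) (k : nat).

Local Arguments node : simpl never.

Lemma node_eq0 T t k : k = 0%N -> node T t k = 0.
Proof. by move=> ->. Qed.

Lemma node_gt T t k : (m < k)%N -> node T t k = T.
Proof. by case: k => // k mk; rewrite /node insubF// ltnNge -ltnS mk. Qed.

Lemma node_last T t : node T t m.+1 = T.
Proof. exact: node_gt. Qed.

Lemma node_ord T t (i : 'I_m) : node T t i.+1 = t 0 i.
Proof. by rewrite /node valK. Qed.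

Lemma node_mono T t j k : feasible T t -> (j <= k)%N -> (k <= m.+1)%N ->
  node T t j <= node T t k.
Proof.
move=> ft; elim: k => [|k IH]; first by rewrite leqn0 => /eqP ->.
rewrite leq_eqVlt => /predU1P[->//|jk km].
by apply: le_trans (IH jk (ltnW km)) _; exact: ft.
Qed.

Lemma node_itv T t k : feasible T t -> (k <= m.+1)%N -> 0 <= node T t k <= T.
Proof.
move=> ft km; rewrite -[X in X <= _](erefl : node T t 0 = 0).
by rewrite -[X in _ && (_ <= X)](node_last T t) !node_mono.
Qed.

(* The 1-based index of the piece of [v^{t,a}] that contains [x]. *)
Definition kappa T t x : nat := find (fun k => x < node T t k) (iota 0 m.+2).

Section Kappa.
Variables (T : R) (t : 'rV[R]_m) (x : R).
Hypotheses (ft : feasible T t) (xT : x \in `]0, T[).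

Let x_gt0 : 0 < x. Proof. by move: xT; rewrite in_itv/= => /andP[]. Qed.
Let x_ltT : x < T. Proof. by move: xT; rewrite in_itv/= => /andP[]. Qed.

Let has_kappa : has (fun k => x < node T t k) (iota 0 m.+2).
Proof.
apply/hasP; exists m.+1; first by rewrite mem_iota ltnS leqnn.
by rewrite node_last.
Qed.

Lemma kappa_le : (kappa T t x <= m.+1)%N.
Proof. by move: has_kappa; rewrite has_find size_iota ltnS. Qed.

Lemma lt_node_kappa : x < node T t (kappa T t x).
Proof.
have := nth_find 0%N has_kappa.
by rewrite nth_iota// ltnS kappa_le.
Qed.

(** The nodes are nondecreasing, so those at or below [x] are exactly the ones passed before the
    first node beyond [x]. This turns comparisons of piece indices into comparisons with nodes. *)
Lemma ltn_kappa k : (k <= m.+1)%N -> (k < kappa T t x)%N = (node T t k <= x).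
Proof.
move=> km; have [kk|kk] := ltnP k (kappa T t x).
  have := before_find 0%N kk.
  by rewrite nth_iota ?ltnS// add0n => /negbT; rewrite -leNgt => ->.
apply/esym/negbTE; rewrite -ltNge; apply: lt_le_trans lt_node_kappa _.
exact: node_mono.
Qed.

Lemma kappa_gt0 : (0 < kappa T t x)%N.
Proof. by rewrite ltn_kappa// ltW. Qed.

Lemma kappa_eq k : (0 < k <= m.+1)%N -> node T t k.-1 <= x -> x < node T t k ->
  kappa T t x = k.
Proof.
move=> /andP[k0 km] kx xk; apply/eqP; rewrite eqn_leq; apply/andP; split.
  by rewrite leqNgt ltn_kappa// -ltNge.
by rewrite -(prednK k0) ltn_kappa// (leq_trans (leq_pred _)).
Qed.

Lemma pieceE k : (0 < k <= m.+1)%N -> (x \in piece T t k) = (k == kappa T t x).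
Proof.
move=> /andP[k0 km]; have k1m : (k.-1 <= m.+1)%N by rewrite (leq_trans (leq_pred _)).
apply/idP/eqP => [|->].
  rewrite inE => xk; apply/esym/kappa_eq; first by rewrite k0.
    move: xk; rewrite /piece; case: eqP => [-> |_] /=; rewrite in_itv/=.
      by move=> _; rewrite ltW.
    by move=> /andP[].
  move: xk; rewrite /piece; case: eqP => [-> |_] /=; rewrite in_itv/=; by case/andP.
rewrite inE /piece; case: eqP => [k1|_] /=; rewrite in_itv/=.
  by apply/andP; split; [exact: x_gt0|rewrite -k1 lt_node_kappa].
rewrite lt_node_kappa andbT -ltn_kappa; first by rewrite prednK ?kappa_gt0.
by rewrite (leq_trans (leq_pred _))// kappa_le.
Qed.

Lemma vfunE a : vfun T t a x = level a (kappa T t x).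
Proof.
rewrite /vfun (bigD1_seq (kappa T t x)) ?iota_uniq//=; last first.
  by rewrite mem_index_iota kappa_gt0 ltnS kappa_le.
rewrite indicE pieceE ?kappa_gt0 ?kappa_le// eqxx scale1r big1_seq ?addr0//.
move=> k /andP[kn]; rewrite mem_index_iota ltnS => kI.
by rewrite indicE pieceE// (negbTE kn) scale0r.
Qed.

(** Telescoping along the levels. In this form coinciding nodes need no special treatment: their
    jumps are switched on together. *)
Lemma vfun_jumps a : vfun T t a x = level a 1 +
  \sum_(1 <= k < m.+1) (node T t k <= x)%R%:R *: (level a k.+1 - level a k).
Proof.
rewrite vfunE; have k0 := kappa_gt0.
have -> : level a (kappa T t x) = level a 1 +
    \sum_(1 <= k < kappa T t x) (level a k.+1 - level a k).
  by rewrite telescope_sumr// addrCA subrr addr0.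
congr (_ + _); rewrite (big_nat_widen _ _ _ _ _ kappa_le)/=.
rewrite big_mkcond; apply: eq_big_nat => k /andP[k1 km].
by rewrite ltn_kappa ?(ltnW km)//; case: ifP; rewrite ?scale1r ?scale0r.
Qed.

End Kappa.

Lemma inL1_vfun T t a : inL1 T (vfun T t a).
Proof.
move=> i.
have -> : (fun x => (vfun T t a x 0 i)%:E) = (fun x =>
    (\sum_(j <- index_iota 1 m.+2) (\1_(piece T t j) x * level a j 0 i)%:E)%E).
  apply/funext => x; rewrite /vfun summxE sumEFin; congr EFin.
  by apply: eq_bigr => j _; rewrite mxE.
apply: integrable_sum => // j _.
have ij : mu.-integrable setT (EFin \o \1_(piece T t j)).
  by rewrite /piece; case: ifP => _; exact: integrable_indic_itv.
have := integrableZr measurableT (level a j 0 i) ij.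
by apply: integrableS.
Qed.

End StepFunctions.

(** * Variation of step functions *)

Section StepVariation.
Context {R : realType}.
Notation mu := (@lebesgue_measure R).

Lemma integrable_scale (D : set R) (f : R -> R) (c : R) : measurable D ->
  mu.-integrable D (EFin \o f) -> mu.-integrable D (EFin \o (fun x => c * f x)).
Proof.
move=> mD fi; rewrite (_ : _ \o _ = (fun x => c%:E * (EFin \o f) x)%E)//.
exact: integrableZl.
Qed.

Lemma Rintegral_derive1_from (g : R -> R) (T c : R) : 0 <= c <= T ->
  (forall t, derivable g t 1) -> continuous (derive1 g) ->
  \int[mu]_(t in `]0, T[%classic) ((c <= t)%R%:R * derive1 g t) = g T - g c.
Proof.
move=> /andP[]; rewrite le_eqVlt => /predU1P[<- T0|c0 cT] dg cg.
  rewrite -(@Rintegral_derive1 _ g 0 T T0 dg cg); apply: eq_Rintegral => t.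
  by rewrite inE/= in_itv/= => /andP[/ltW -> _]; rewrite mul1r.
have gi : mu.-integrable `]c, T[%classic (EFin \o derive1 g).
  have h := integrable_mul_continuous (D := `]c, T[%classic) (measurable_itv _)
    (@subset_refl _ _) (integrable_cst_itv 1 c T) cg.
  by apply: eq_integrable h => // t _; rewrite /= mul1r.
rewrite -(@Rintegral_derive1 _ g c T cT dg cg) (Rintegral_itv_obnd_cbnd gi).
have -> : `[c, T[%classic = `]0, T[ `&` `[c, T[ :> set R.
  rewrite setIidr// => t /=; rewrite !in_itv/= => /andP[ct ->].
  by rewrite (lt_le_trans c0).
rewrite Rintegral_mkcondr; apply: eq_Rintegral => t.
rewrite inE/= in_itv/= => /andP[t0 tT]; rewrite patchE.
case: ifPn => [|].
  by rewrite inE/= in_itv/= => /andP[-> _]; rewrite mul1r.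
by rewrite notin_setE/= in_itv/= tT andbT => /negP/negbTE ->; rewrite mul0r.
Qed.

Context {M m : nat}.
Implicit Types (T : R) (t s : 'rV[R]_m) (a : 'I_m.+1 -> 'rV[R]_M) (k : nat).

Definition jump a k : 'rV[R]_M := level a k.+2 - level a k.+1.

Lemma vfun_jump T t a x : feasible T t -> x \in `]0, T[ -> vfun T t a x =
  level a 1 + \sum_(k < m) (node T t k.+1 <= x)%R%:R *: jump a k.
Proof. by move=> ft xT; rewrite vfun_jumps// big_add1 big_mkord. Qed.

(** Each step contributes phi(T) - phi(node) by the fundamental theorem. As [phi] vanishes at 0 and
    T, the first level drops out, and nodes sitting at 0 or T contribute nothing. *)
Lemma pairing_vfun T t a phi : 0 <= T -> feasible T t -> C1c T phi ->
  pairing T (vfun T t a) phi = - \sum_(k < m) dotp (jump a k) (phi (node T t k.+1)).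
Proof.
move=> T0 ft cphi; rewrite (pairingE (inL1_vfun _ _ _) cphi).
have [dphi cdphi _ _] := cphi.
have out c : c \notin `]0, T[ -> phi c = 0 by move=> /(C1c_out cphi)[].
have phi0 : phi 0 = 0 by apply: out; rewrite in_itv/= ltxx.
have phiT : phi T = 0 by apply: out; rewrite in_itv/= ltxx andbF.
transitivity (\sum_i \sum_(k < m) - (jump a k 0 i * phi (node T t k.+1) 0 i)).
  apply: eq_bigr => i _; set g : R -> R := fun x => phi x 0 i.
  (* Index 0 carries the first level as a step at 0; index k > 0 carries the jump at the k-th
     node. *)
  pose ff (k : 'I_m.+1) x : R :=
    if k == ord0 then level a 1 0 i * ((0 <= x)%R%:R * derive1 g x)
    else jump a k.-1 0 i * ((node T t k <= x)%R%:R * derive1 g x).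
  have ii c : 0 <= c <= T -> mu.-integrable `]0, T[%classic
      (EFin \o (fun x => (c <= x)%R%:R * derive1 g x)).
    move=> cT; apply: (@integrable_mul_continuous _ _ _ _ 0 T) => //.
      rewrite (_ : _ \o _ = EFin \o \1_(`[c, +oo[%classic)); last first.
        by apply/funext => x /=; rewrite indicE mem_setE in_itv/= andbT.
      apply: measurable_bounded_integrable => //.
      - rewrite [X in (X < _)%E](lebesgue_measure_itv `]0, T[).
        by case: ifP => // _; rewrite -EFinD ltry.
      - exists 1; split=> // d d1 x _ /=; rewrite indicE.
        by case: (_ \in _); rewrite ?normr1 ?normr0 ltW// (lt_trans ltr01).
    exact: cdphi.
  have ni (k : 'I_m.+1) : 0 <= node T t k <= T.
    by apply: node_itv => //; exact: ltnW.
  have z0 : 0 <= (0 : R) <= T by rewrite lexx.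
  have fi (k : 'I_m.+1) : mu.-integrable `]0, T[%classic (EFin \o ff k).
    by rewrite /ff; case: (k == ord0); apply: integrable_scale => //; exact: ii.
  rewrite (_ : \int[mu]_(x in _) _ = \int[mu]_(x in `]0, T[%classic) \sum_k ff k x).
    rewrite Rintegral_sum// big_ord_recl /ff eqxx RintegralZl//; last exact: ii.
    rewrite (Rintegral_derive1_from z0 (dphi i) (cdphi i)) /g /= phi0 phiT subrr mulr0 add0r.
    apply: eq_bigr => k _; rewrite RintegralZl//; last exact: ii (ni (lift ord0 k)).
    rewrite (Rintegral_derive1_from (ni (lift ord0 k)) (dphi i) (cdphi i)).
    have z : (0 : 'rV[R]_M) 0 i = 0 by rewrite mxE.
    by rewrite phiT z sub0r mulrN.
  apply: eq_Rintegral => x; rewrite inE/= => xT.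
  rewrite vfun_jump// mxE summxE mulrDl big_ord_recl /ff eqxx.
  have -> : (0 <= x) by move: xT; rewrite in_itv/= => /andP[/ltW].
  rewrite mul1r mulr_suml; congr (_ + _); apply: eq_bigr => k _.
  by rewrite mxE mulrCA mulrA.
rewrite exchange_big/= -sumrN; apply: eq_bigr => k _.
by rewrite sumrN.
Qed.

(** Hölder's inequality at each node. The bound is independent of the positions of the nodes; it is
    only an inequality because jumps at coinciding nodes may cancel. *)
Lemma TV_vfun_le (p : R) T t a : 1 < p -> 0 <= T -> feasible T t ->
  (TV T p%:E (vfun T t a) <= (\sum_(k < m) vnorm p%:E (jump a k))%:E)%E.
Proof.
move=> p1 T0 ft; apply: TV_le => phi [cphi nphi].
rewrite lee_fin pairing_vfun// -sumrN; apply: ler_sum => k _.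
have p0 := lt_trans ltr01 p1; have q0 := conj_exp_gt0 p1.
rewrite -dotpNr; set c := node _ _ _.
have : vnorm (conj_exp p)%:E (- phi c) <= 1.
  rewrite vnormN//; have [cT|cT] := boolP (c \in `]0, T[).
    by rewrite -(conj_expE p1); exact: nphi.
  by have [-> _] := C1c_out cphi cT; rewrite vnorm0// ler01.
move=> /(ler_wpM2l (vnorm_ge0 p (jump a k))); rewrite mulr1.
by apply: le_trans; exact: (hoelder_dotp p0 q0 (conj_expP p1)).
Qed.

End StepVariation.

Section StepBV.
Context {R : realType} {M m : nat}.
Implicit Types (T : R) (t s : 'rV[R]_m) (a : 'I_m.+1 -> 'rV[R]_M) (k : nat).

Lemma inBV_vfun T t a : 0 <= T -> feasible T t -> inBV T (vfun T t a).
Proof.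
move=> T0 ft; split; first exact: inL1_vfun.
move=> i; pose b (j : 'I_m.+1) : 'rV[R]_1 := \row_(_ < 1) a j 0 i.
have -> : (fun x => \row_(_ < 1) vfun T t a x 0 i) = vfun T t b.
  apply/funext => x; apply/rowP => j; rewrite mxE /vfun !summxE.
  by apply: eq_bigr => k _; rewrite !mxE.
apply: (@le_lt_trans _ _ (\sum_(k < m) `|jump b k 0 0|)%:E); last exact: ltry.
apply: TV_le => phi [cphi nphi]; rewrite lee_fin pairing_vfun// -sumrN.
apply: ler_sum => k _; rewrite /dotp big_ord1; set c := node _ _ _.
apply: le_trans (ler_norm _) _; rewrite normrN normrM -[leRHS]mulr1.
apply: ler_wpM2l => //; have [cT|cT] := boolP (c \in `]0, T[).
  (* The conjugate exponent of 1 is infinity, and on one component the maximum norm is the absolute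
     value. *)
  by have := nphi _ cT; rewrite hoelder_conjugate1 /vnorm big_ord_recl big_ord0 ge_max => /andP[].
by have [-> _] := C1c_out cphi cT; rewrite mxE normr0 ler01.
Qed.

End StepBV.

(** * Clusters of switching points *)

Section Clusters.
Context {R : realType} {M m : nat}.
Variables (T : R) (V : {fset 'rV[int]_M}) (u : R -> 'rV[R]_M).
Variables (a : 'I_m.+1 -> 'rV[R]_M) (t : 'rV[R]_m).
Hypotheses (T_gt0 : 0 < T) (uat : full_representation T V u a t).
Implicit Types (f g h k l : nat).
Local Arguments node : simpl never.

Let ft : feasible T t. Proof. by have [_ _ []] := uat. Qed.

Definition regular k : bool :=
  (0 < k <= m.+1)%N && (node T t k.-1 < node T t k).

Lemma regular_bounds k : regular k -> (0 < k <= m.+1)%N.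
Proof. by case/andP. Qed.

Lemma regular1 : regular 1.
Proof.
rewrite /regular/=; have [_ _ [_ ends] _] := uat.
have [m0|m0] := posnP m; last by have [] := ends m0.
by rewrite (@node_gt _ _ _ _ 1)// m0.
Qed.

Lemma regular_last : regular m.+1.
Proof.
rewrite /regular ltnS leqnn/= node_last; have [_ _ [_ ends] _] := uat.
have [m0|m0] := posnP m; last by have [] := ends m0.
by rewrite node_eq0.
Qed.

Lemma prev_regular k : (0 < k)%N ->
  exists l, [/\ (l <= k)%N, regular l & forall f, (l < f <= k)%N -> ~~ regular f].
Proof.
move=> k0.
have ex : exists l, regular l && (l <= k)%N by exists 1%N; rewrite regular1.
have ub l : regular l && (l <= k)%N -> (l <= k)%N by case/andP.
case: (ex_maxnP ex ub) => l /andP[rl lk] lmax; exists l; split=> // f /andP[lf fk].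
by apply/negP => rf; have := lmax f; rewrite rf fk leqNgt lf => /(_ isT).
Qed.

Lemma next_regular k : (k <= m.+1)%N ->
  exists l, [/\ (k <= l)%N, regular l & forall f, (k <= f < l)%N -> ~~ regular f].
Proof.
move=> km; have ex : exists l, regular l && (k <= l)%N.
  by exists m.+1; rewrite regular_last.
case: (ex_minnP ex) => l /andP[rl kl] lmin; exists l; split=> // f /andP[kf fl].
by apply/negP => rf; have := lmin f; rewrite rf kf leqNgt fl => /(_ isT).
Qed.

(** Only pieces of length zero lie strictly between, so the nodes k, ..., l - 1 coincide: a cluster
    as in condition (iii), with i = k and j = l - 1. *)
Definition consecutive k l : Prop :=
  [/\ regular k, regular l, (k < l)%N & forall f, (k < f < l)%N -> ~~ regular f].

Lemma next_consecutive k : regular k -> (k < m.+1)%N ->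
  exists l, consecutive k l.
Proof.
by move=> rk km; have [l [kl rl H]] := next_regular km; exists l; split.
Qed.

Lemma prev_consecutive l : regular l -> (1 < l)%N ->
  exists k, consecutive k l.
Proof.
move=> rl l1; have [|k [kl rk H]] := @prev_regular l.-1.
  by rewrite -ltnS prednK// ltnW.
have ll : (l.-1 < l)%N by rewrite prednK// ltnW.
exists k; split=> //; first exact: leq_ltn_trans kl ll.
move=> f /andP[kf fl]; apply: H; rewrite kf/= -ltnS prednK//.
exact: ltn_trans l1.
Qed.

Definition line k l (x : R) := (1 - x) *: level a k + x *: level a l.

(** Condition (iii) for i = k and j = l - 1, its parameters extended by 0 and 1 so that the end
    levels are treated like the inner ones. *)
Lemma consecutive_line k l : consecutive k l -> exists lam : nat -> R,
  [/\ lam k = 0, lam l = 1,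
      forall g h, (k <= g)%N -> (g < h)%N -> (h <= l)%N -> lam g < lam h,
      forall h, (k <= h <= l)%N -> level a h = line k l (lam h)
    & forall x, 0 <= x <= 1 -> valset V (line k l x) ->
        exists2 h, (k <= h <= l)%N & lam h = x].
Proof.
move=> [/andP[/andP[k0 km] nk] /andP[/andP[l0 lm] nl] kl none].
have l1 : (0 < l.-1)%N by rewrite -ltnS prednK// (leq_ltn_trans k0).
have kl1 : (k <= l.-1)%N by rewrite -ltnS prednK.
have same : node T t k = node T t l.-1.
  have H j : (j < l - k)%N -> node T t k = node T t (k + j).
    elim: j => [|j IH] jl; first by rewrite addn0.
    rewrite IH ?(ltnW jl)//.
    have := none (k + j.+1)%N; rewrite addnS ltnS leq_addr/=.
    have kj : ((k + j).+1 < l)%N by rewrite -addnS -ltn_subRL.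
    rewrite kj => /(_ isT); rewrite /regular/= (leq_trans (ltnW kj) lm)/= -leNgt => le.
    by apply/eqP; rewrite eq_le le andbT; apply: ft; rewrite -ltnS (leq_trans _ lm)// ltnW.
  by rewrite (H (l.-1 - k)%N) ?subnKC// ltn_sub2r// prednK.
have [_ _ _ /(_ k l.-1 k0 kl1)] := uat.
rewrite prednK// => /(_ _ nk same nl); rewrite -ltnS prednK// => /(_ lm).
move=> [lam [lam_line lam_mono lam_all]].
pose L h := if (h <= k)%N then 0 else if (l <= h)%N then 1 else lam h.
have Lk : L k = 0 by rewrite /L leqnn.
have Ll : L l = 1 by rewrite /L leqNgt kl/= leqnn.
have Lm h : (k < h < l)%N -> L h = lam h.
  by move=> /andP[kh hl]; rewrite /L leqNgt kh/= leqNgt hl.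
have le1 h : (h < l)%N -> (h <= l.-1)%N by move=> hl; rewrite -ltnS prednK.
have line0 : line k l 0 = level a k by rewrite /line subr0 scale1r scale0r addr0.
have line1 : line k l 1 = level a l by rewrite /line subrr scale1r scale0r add0r.
exists L; split=> //.
- move=> g h kg gh hl.
  have Hin f : (k < f < l)%N -> 0 < L f < 1.
    move=> /[dup] kfl /andP[kf fl]; rewrite Lm//.
    by have [] := lam_line f; first by rewrite kf le1.
  move: kg; rewrite leq_eqVlt => /predU1P[kE|kg].
    rewrite -kE in gh *; rewrite Lk.
    move: hl; rewrite leq_eqVlt => /predU1P[->|hl]; first by rewrite Ll.
    by have /andP[] : 0 < L h < 1 by apply: Hin; rewrite gh hl.
  have gl : (g < l)%N by exact: leq_trans hl.
  move: hl; rewrite leq_eqVlt => /predU1P[hE|hl].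
    by rewrite hE Ll; have /andP[] : 0 < L g < 1 by apply: Hin; rewrite kg gl.
  rewrite !Lm ?kg ?gl ?hl ?(ltn_trans kg gh)//.
  by apply: lam_mono => //; exact: le1.
- move=> h /andP[]; rewrite leq_eqVlt => /predU1P[<-|kh]; first by rewrite Lk line0.
  rewrite leq_eqVlt => /predU1P[->|hl]; first by rewrite Ll line1.
  by rewrite Lm ?kh//; have [] := lam_line h; first by rewrite kh le1.
- move=> x /andP[]; rewrite le_eqVlt => /predU1P[<- _ _|x0].
    by exists k => //; rewrite leqnn ltnW.
  rewrite le_eqVlt => /predU1P[-> _|x1 xV].
    by exists l => //; rewrite leqnn andbT ltnW.
  have [|h /andP[kh hl] <-] := lam_all x _ xV; first by rewrite x0.
  have hl' : (h < l)%N by rewrite -(prednK l0) ltnS.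
  by exists h; [rewrite (ltnW kh) (ltnW hl')|rewrite Lm ?kh].
Qed.

Lemma lineB k l x y : line k l y - line k l x = (y - x) *: (level a l - level a k).
Proof. by apply/rowP => i; rewrite !mxE; ring. Qed.

Lemma valset_level k : valset V (level a k).
Proof. by have [aV _ _ _] := uat; exact: aV. Qed.

(** Were the end levels equal, the line would be constant and every parameter in [0,1] would have to
    be attained. The midpoint of [lam k] = 0 and [lam k.+1] is skipped by the increasing
    sequence. *)
Lemma consecutive_neq k l : consecutive k l -> level a k != level a l.
Proof.
move=> ckl; have [_ _ kl _] := ckl.
have [lam [lk ll lam_mono _ lam_all]] := consecutive_line ckl.
apply/eqP => E; have lk1 : lam k < lam k.+1 by exact: lam_mono.
have lk1l : lam k.+1 <= 1.
  move: kl; rewrite leq_eqVlt => /predU1P[->|kl]; first by rewrite ll.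
  by rewrite -ll ltW// lam_mono.
rewrite lk in lk1.
have [||h /andP[kh hl] hE] := lam_all (lam k.+1 / 2).
- by apply/andP; split; lra.
- by rewrite /line -E -scalerDl subrK scale1r; exact: valset_level.
move: kh; rewrite leq_eqVlt => /predU1P[kh|kh].
  by move: hE; rewrite -kh lk; lra.
have : lam k.+1 <= lam h.
  move: kh; rewrite leq_eqVlt => /predU1P[->//|kh].
  by apply/ltW/lam_mono.
by rewrite hE; lra.
Qed.

(** The nearest regular indices around [g] and [h] form a consecutive pair, so both levels belong to
    one cluster: points of a nondegenerate segment with strictly increasing parameters. *)
Lemma level_neq g h : (0 < g)%N -> (g < h)%N -> (h <= m.+1)%N ->
  (forall f, (g < f < h)%N -> ~~ regular f) -> level a g != level a h.
Proof.
move=> g0 gh hm none.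
have [k [kg rk Hk]] := prev_regular g0; have [l [hl rl Hl]] := next_regular hm.
have kl : (k < l)%N by apply: leq_trans hl; exact: leq_ltn_trans gh.
have ckl : consecutive k l.
  split=> // f /andP[kf fl]; have [fg|gf] := leqP f g; first by rewrite Hk// kf.
  have [hf|fh] := leqP h f; first by rewrite Hl// hf.
  by rewrite none// gf.
have [lam [lk ll lam_mono lam_line _]] := consecutive_line ckl.
rewrite -subr_eq0 !lam_line; last 2 first.
- by rewrite hl (leq_trans kg)// ltnW.
- by rewrite kg (leq_trans (ltnW gh)).
rewrite lineB scaler_eq0 negb_or subr_eq0 eq_sym subr_eq0.
rewrite [level a l == _]eq_sym consecutive_neq// andbT eq_sym.
by rewrite lt_eqF//; exact: lam_mono.
Qed.

Section Length.
Variable N : 'rV[R]_M -> R.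
Hypothesis NZ : forall c x, N (c *: x) = `|c| * N x.

Definition level_length k : R := \sum_(1 <= h < k) N (level a h.+1 - level a h).

(** The levels of a cluster are aligned in order, so their increments are nonnegative multiples of
    one vector, and the factors telescope to 1. *)
Lemma consecutive_length k l : consecutive k l ->
  level_length l - level_length k = N (level a l - level a k).
Proof.
move=> ckl; have [rk rl kl _] := ckl; have /andP[k0 _] := regular_bounds rk.
have [lam [lk ll lam_mono lam_line _]] := consecutive_line ckl.
rewrite /level_length (@big_cat_nat _ _ _ k 1 l)//=; last exact: ltnW.
rewrite addrC addrK.
transitivity (\sum_(k <= h < l) (lam h.+1 - lam h) * N (level a l - level a k)).
  apply: eq_big_nat => h /andP[kh hl].
  rewrite (lam_line h.+1); last by rewrite hl (leq_trans kh).
  rewrite (lam_line h); last by rewrite kh ltnW.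
  have lam_h : 0 < lam h.+1 - lam h by rewrite subr_gt0 lam_mono.
  by rewrite lineB NZ (gtr0_norm lam_h).
by rewrite -mulr_suml telescope_sumr ?(ltnW kl)// ll lk subr0 mul1r.
Qed.

Lemma level_length1 : level_length 1 = 0.
Proof. by rewrite /level_length big_geq. Qed.

Lemma level_length_last : level_length m.+1 = \sum_(k < m) N (jump a k).
Proof. by rewrite /level_length big_add1 big_mkord. Qed.

End Length.
End Clusters.

(** * Equality in the triangle inequality *)

Section Segment.
Context {R : realType} {M : nat}.
Variable N : 'rV[R]_M -> R.
Implicit Types b c d e x y : 'rV[R]_M.

Definition strict_norm : Prop :=
  [/\ forall x, 0 <= N x, forall x, N x = 0 -> x = 0,
      forall r x, N (r *: x) = `|r| * N x, forall x y, N (x + y) <= N x + N y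
    & forall x y, N (x + y) = N x + N y -> N y *: x = N x *: y].

Hypothesis HN : strict_norm.

Lemma subr_chain b c d : (c - b) + (d - c) = d - b.
Proof. by rewrite addrC addrA subrK. Qed.

Lemma normB_tri b c d : N (d - b) <= N (c - b) + N (d - c).
Proof.
by have [_ _ _ ND _] := HN; have := ND (c - b) (d - c); rewrite subr_chain.
Qed.

Lemma on_segment b c d : N (c - b) + N (d - c) = N (d - b) -> b != d ->
  c = (1 - N (c - b) / N (d - b)) *: b + (N (c - b) / N (d - b)) *: d.
Proof.
have [N0 Neq0 _ _ Neq] := HN => E bd.
have Nn : N (d - b) != 0.
  by apply: contra bd => /eqP/Neq0/eqP; rewrite subr_eq0 eq_sym.
have E1 : N ((c - b) + (d - c)) = N (c - b) + N (d - c).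
  by rewrite subr_chain E.
have {}E1 : N (d - b) *: (c - b) = N (c - b) *: (d - b).
  by rewrite -E scalerDl (Neq _ _ E1) -scalerDr subr_chain.
have : c - b = (N (c - b) / N (d - b)) *: (d - b).
  by rewrite mulrC -scalerA -E1 scalerA mulVf// scale1r.
move: (_ / _) => r cE; apply/(addIr (- b)); rewrite [LHS]cE.
by apply/rowP => i; rewrite !mxE; ring.
Qed.

Lemma squeeze4 (A B C D X Y : R) :
  A + B + C = D -> X <= A + B -> D <= X + C -> Y <= B + C -> D <= A + Y ->
  [/\ X + C = D, A + Y = D & X = A + B].
Proof. by move=> *; split; lra. Qed.

(** Equality along the four-point path forces equality along both three-point paths from [b] to [e],
    which puts [c] and [d] on the segment, and along the path from [b] to [d], which orders the
    parameters. *)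
Lemma on_segment2 b c d e : N (c - b) + N (d - c) + N (e - d) = N (e - b) ->
  b != e -> exists r1 r2 : R, [/\ 0 <= r1, r1 <= r2, r2 <= 1,
    c = (1 - r1) *: b + r1 *: e & d = (1 - r2) *: b + r2 *: e].
Proof.
have [N0 Neq0 _ _ _] := HN => E be.
have [E2 E1 E3] := squeeze4 E (normB_tri b c d) (normB_tri b d e)
  (normB_tri c d e) (normB_tri b c e).
have Np : 0 < N (e - b).
  rewrite lt_neqAle N0 andbT eq_sym.
  by apply: contra be => /eqP/Neq0/eqP; rewrite subr_eq0 eq_sym.
exists (N (c - b) / N (e - b)), (N (d - b) / N (e - b)); split.
- by rewrite divr_ge0.
- by rewrite ler_pM2r ?invr_gt0// E3 lerDl.
- by rewrite ler_pdivrMr// mul1r -E2 lerDl.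
- exact: on_segment.
- exact: on_segment.
Qed.

(* Finiteness of [V] makes the excess over the shortest path a discrete
   quantity. *)
Definition excess_gap (V : {fset 'rV[int]_M}) (delta : R) : Prop :=
  (forall b c d e, valset V b -> valset V c -> valset V d -> valset V e ->
    N (c - b) + N (d - c) + N (e - d) < N (e - b) + delta ->
    N (c - b) + N (d - c) + N (e - d) = N (e - b)) /\
  (forall b c, valset V b -> valset V c -> N (c - b) < delta -> b = c).

End Segment.

(** * Level indices of a function of almost minimal variation ([P x] stands for the variation on
    (0,x), [Q] for that on (0,T)) *)

Section MonotoneLevels.
Context {R : realType} {M m : nat}.
Variables (T : R) (V : {fset 'rV[int]_M}) (u : R -> 'rV[R]_M).
Variables (a : 'I_m.+1 -> 'rV[R]_M) (t : 'rV[R]_m).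
Hypotheses (T_gt0 : 0 < T) (uat : full_representation T V u a t).
Variables (N : 'rV[R]_M -> R) (HN : strict_norm N).
Variables (G : R -> Prop) (w : R -> 'rV[R]_M) (P : R -> R) (Q : R) (z : nat -> R).
Hypotheses (P_ge0 : forall x, 0 <= P x) (P_le : forall x, G x -> P x <= Q)
  (PD : forall x y, G x -> G y -> x < y -> P x + N (w y - w x) <= P y).
Hypothesis zP : forall k, regular T t k ->
  [/\ G (z k), w (z k) = level a k & node T t k.-1 < z k < node T t k].
Implicit Types (f g h k l : nat) (x y : R).

Let ft : feasible T t. Proof. by have [_ _ []] := uat. Qed.
Let N0 : N 0 = 0.
Proof.
by have [_ _ NZ _ _] := HN; rewrite -(scale0r (0 : 'rV[R]_M)) NZ normr0 mul0r.
Qed.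

Lemma PD_le x y : G x -> G y -> x <= y -> P x + N (w y - w x) <= P y.
Proof.
by move=> Gx Gy; rewrite le_eqVlt => /predU1P[->|]; [rewrite subrr N0 addr0|exact: PD].
Qed.

Lemma z_lt k l : regular T t k -> regular T t l -> (k < l)%N -> z k < z l.
Proof.
move=> rk rl kl; have [_ _ /andP[_ zk]] := zP rk; have [_ _ /andP[zl _]] := zP rl.
apply: lt_trans zk (le_lt_trans _ zl).
have /andP[l0 lm] := regular_bounds rl.
apply: node_mono => //; first by rewrite -ltnS prednK.
exact: leq_trans (leq_pred _) lm.
Qed.

Lemma z_le k l : regular T t k -> regular T t l -> z k <= z l -> (k <= l)%N.
Proof.
by move=> rk rl zkl; rewrite leqNgt; apply/negP => /(z_lt rl rk); rewrite ltNge zkl.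
Qed.

(** Induction over consecutive regular indices: between neighbouring base points [P] grows at least
    by the distance of the two levels, which is the length of the cluster. *)
Lemma length_le k l : regular T t k -> regular T t l -> (k <= l)%N ->
  level_length a N l - level_length a N k <= P (z l) - P (z k).
Proof.
have [_ _ NZ _ _] := HN.
elim/ltn_ind: l => l IH rk rl; rewrite leq_eqVlt => /predU1P[->|kl].
  by rewrite !subrr.
have l1 : (1 < l)%N by apply: leq_ltn_trans kl; case/andP: (regular_bounds rk).
have [j jl] := prev_consecutive T_gt0 uat rl l1; have [rj _ ltjl none] := jl.
have kj : (k <= j)%N.
  by rewrite leqNgt; apply/negP => jk; have := none k; rewrite jk kl rk => /(_ isT).
have IHj := IH _ ltjl rk rj kj.
have lenE := consecutive_length uat NZ jl.
have [Gj wj _] := zP rj; have [Gl wl _] := zP rl.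
have := PD Gj Gl (z_lt rj rl ltjl); rewrite wj wl -lenE => PDj.
lra.
Qed.

Lemma total_length_le : level_length a N m.+1 <= Q.
Proof.
have r1 := regular1 T_gt0 uat; have rn := regular_last T_gt0 uat.
have [Gn _ _] := zP rn.
have := length_le r1 rn isT; rewrite level_length1 subr0 => H.
apply: le_trans H (le_trans _ (P_le Gn)).
by rewrite lerBlDr lerDl P_ge0.
Qed.

Variable delta : R.
Hypotheses (gap : excess_gap N V delta) (Q_lt : Q < level_length a N m.+1 + delta).
Hypothesis (wV : forall x, G x -> valset V (w x)).

(* [x] may carry the level index [h]: no base point separates them. *)
Definition has_index x h : Prop :=
  [/\ (0 < h <= m.+1)%N, w x = level a h
    & forall f, regular T t f -> (z f <= x -> (f <= h)%N) /\ (x <= z f -> (h <= f)%N)].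

(** By [level_neq], two indices with the same level are separated by a regular one, whose base point
    lies on one side of [x] and so excludes one of them. *)
Lemma has_index_uniq x g h : has_index x g -> has_index x h -> g = h.
Proof.
have H g' h' : (g' < h')%N -> has_index x g' -> has_index x h' -> False.
  move=> gh [/andP[g0 gm] wg Hg] [/andP[h0 hm] wh Hh].
  have : level a g' != level a h'.
    apply: (level_neq T_gt0 uat) => // f /andP[gf fh]; apply/negP => rf.
    have [xf|fx] := lerP (z f) x.
      by have [/(_ xf)] := Hg _ rf; rewrite leqNgt gf.
    by have [_ /(_ (ltW fx))] := Hh _ rf; rewrite leqNgt fh.
  by rewrite -wg -wh eqxx.
by move=> Hg Hh; have [gh|hg|//] := ltngtP g h; [case: (H g h)|case: (H h g)].
Qed.

(** Before [z k] and after [z l] the path already consumes the length of the levels there, so the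
    total excess, which is below [delta], bounds the excess in this zone. *)
Lemma excess_between k l x y : consecutive T t k l -> G x -> G y ->
  z k <= x -> x <= y -> y <= z l ->
  N (w x - level a k) + N (w y - w x) + N (level a l - w y) <
  N (level a l - level a k) + delta.
Proof.
have [_ _ NZ _ _] := HN.
move=> kl Gx Gy kx xy yl; have [rk rl ltkl _] := kl.
have [Gk wk _] := zP rk; have [Gl wl _] := zP rl.
have r1 := regular1 T_gt0 uat; have rn := regular_last T_gt0 uat.
have [Gn _ _] := zP rn; have PQ := P_le Gn; have P0 := P_ge0 (z 1%N).
have /andP[k0 km] := regular_bounds rk; have /andP[l0 lm] := regular_bounds rl.
have L1 := length_le r1 rk k0; have L2 := length_le rl rn lm.
have D1 := PD_le Gk Gx kx; have D2 := PD_le Gx Gy xy; have D3 := PD_le Gy Gl yl.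
have lenE := consecutive_length uat NZ kl.
move: Q_lt; rewrite -lenE -wk -wl; rewrite level_length1 in L1.
lra.
Qed.

(** An excess below the gap is zero, so both values lie on the segment, in the order of the points;
    completeness in condition (iii) turns their parameters into indices. Handling two points at once
    is what yields monotonicity. *)
Lemma zone_index k l x y : consecutive T t k l -> G x -> G y ->
  z k <= x -> x <= y -> y < z l ->
  exists g h, [/\ (g <= h)%N, has_index x g & has_index y h].
Proof.
move=> kl Gx Gy kx xy yl; have [rk rl ltkl none] := kl.
have E := (proj1 gap) _ _ _ _ (valset_level uat k) (wV Gx) (wV Gy)
  (valset_level uat l) (excess_between kl Gx Gy kx xy (ltW yl)).
have [r1 [r2 [r10 r12 r21 wx wy]]] := on_segment2 HN E (consecutive_neq uat kl).
have [lam [lk ll lam_mono lam_line lam_all]] := consecutive_line uat kl.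
have [||g /andP[kg gl] gE] := lam_all r1.
- by rewrite r10 (le_trans r12).
- by rewrite /line -wx; exact: wV.
have [||h /andP[kh hl] hE] := lam_all r2.
- by rewrite r21 (le_trans r10).
- by rewrite /line -wy; exact: wV.
have /andP[k0 km] := regular_bounds rk; have /andP[l0 lm] := regular_bounds rl.
(* Any index of the cluster with the right level is compatible with all base points. The delicate
   case is [v] = [z k]: the index must then be [k], since a larger one belongs to a different
   level. *)
have idx v j : z k <= v -> v < z l -> (k <= j)%N -> (j <= l)%N ->
    w v = level a j -> has_index v j.
  move=> kv vl kj jl wv; split=> //.
    by rewrite (leq_trans k0 kj) (leq_trans jl lm).
  move=> f rf; split=> [fv|vf].
    have fl : (f < l)%N.
      rewrite ltnNge; apply/negP => lf; have : z l <= z f.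
        by move: lf; rewrite leq_eqVlt => /predU1P[->//|lf]; rewrite ltW// z_lt.
      by rewrite leNgt (le_lt_trans fv vl).
    apply: leq_trans kj; rewrite leqNgt; apply/negP => kf.
    by have := none f; rewrite kf fl rf => /(_ isT).
  have [fk|kf] := leqP f k; last first.
    apply: leq_trans jl _; rewrite leqNgt; apply/negP => fl.
    by have := none f; rewrite kf fl rf => /(_ isT).
  have zfk : z f = z k.
    apply/eqP; rewrite eq_le (le_trans kv vf) andbT.
    move: fk; rewrite leq_eqVlt => /predU1P[->//|fk].
    by rewrite ltW// z_lt.
  have fE : f = k.
    by apply/eqP; rewrite eqn_leq fk z_le// zfk.
  have vE : v = z k by apply/eqP; rewrite eq_le kv -zfk vf.
  have [_ wk _] := zP rk.
  rewrite fE leqNgt; apply/negP => ltkj.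
  have lt_lam : lam k < lam j by exact: lam_mono.
  have : line a k l (lam j) - line a k l (lam k) = 0.
    have <- : level a j = line a k l (lam j) by apply: lam_line; rewrite kj.
    have <- : level a k = line a k l (lam k).
      by apply: lam_line; rewrite leqnn ltnW.
    by rewrite -wv vE wk subrr.
  move/eqP; rewrite lineB scaler_eq0 !subr_eq0 (eq_sym (level a l)).
  by rewrite (negbTE (consecutive_neq uat kl)) orbF gt_eqF.
exists g, h; split.
- rewrite leqNgt; apply/negP => hg; have := lam_mono _ _ kh hg gl.
  by rewrite gE hE ltNge r12.
- apply: idx => //; first exact: le_lt_trans yl.
  by rewrite lam_line ?kg// gE /line -wx.
- apply: idx => //; first exact: le_trans xy.
  by rewrite lam_line ?kh// hE /line -wy.
Qed.

Lemma zones x : x < z 1%N \/ z m.+1 <= x \/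
  exists k l, [/\ consecutive T t k l, z k <= x & x < z l].
Proof.
have r1 := regular1 T_gt0 uat; have rn := regular_last T_gt0 uat.
have [x1|x1] := ltP x (z 1%N); first by left.
have [xn|xn] := lerP (z m.+1) x; first by right; left.
right; right.
have ex : exists k, regular T t k && (z k <= x) by exists 1%N; rewrite r1.
have ub k : regular T t k && (z k <= x) -> (k <= m.+1)%N.
  by case/andP=> /regular_bounds/andP[].
case: (ex_maxnP ex ub) => k /andP[rk kx] kmax.
have km : (k < m.+1)%N.
  have /andP[_ ] := regular_bounds rk; rewrite leq_eqVlt => /predU1P[kE|//].
  by move: kx; rewrite kE leNgt xn.
have [l kl] := next_consecutive T_gt0 uat rk km; have [_ rl ltkl _] := kl.
exists k, l; split=> //; rewrite ltNge; apply/negP => lx.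
by have := kmax l; rewrite rl lx leqNgt ltkl => /(_ isT).
Qed.

(** A change of value before the first base point would come on top of the full length of the
    levels; less than [delta] is left for it, and the second half of [gap] excludes it. *)
Lemma first_index x : G x -> x < z 1%N -> has_index x 1.
Proof.
move=> Gx x1.
have r1 := regular1 T_gt0 uat; have rn := regular_last T_gt0 uat.
have [G1 w1 _] := zP r1; have [Gn _ _] := zP rn.
have H1 := PD Gx G1 x1; have H2 := length_le r1 rn isT.
have H3 := P_le Gn; have H4 := P_ge0 x.
split=> //.
  rewrite -w1; apply: (proj2 gap); [exact: wV|exact: wV|].
  rewrite level_length1 in H2; move: Q_lt; lra.
move=> f rf; split=> [fx|_]; last by case/andP: (regular_bounds rf).
have /andP[f0 _] := regular_bounds rf.
have : z 1%N <= z f.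
  move: f0; rewrite leq_eqVlt => /predU1P[<-//|f1].
  by rewrite ltW// z_lt.
by rewrite leNgt (le_lt_trans fx x1).
Qed.

Lemma last_index x : G x -> z m.+1 <= x -> has_index x m.+1.
Proof.
move=> Gx xn.
have r1 := regular1 T_gt0 uat; have rn := regular_last T_gt0 uat.
have [G1 _ _] := zP r1; have [Gn wn _] := zP rn.
have H1 := PD_le Gn Gx xn; have H2 := length_le r1 rn isT.
have H3 := P_le Gx; have H4 := P_ge0 (z 1%N).
split; first by rewrite ltnS leqnn.
  rewrite -wn; apply/esym/(proj2 gap); [exact: wV|exact: wV|].
  rewrite level_length1 in H2; move: Q_lt; lra.
move=> f rf; have /andP[f0 fm] := regular_bounds rf.
split=> // xf; move: fm; rewrite leq_eqVlt => /predU1P[->//|fm].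
have := z_lt rf rn fm; rewrite ltNge => /negP; case.
exact: le_trans xf.
Qed.

Lemma has_index_ex x : G x -> exists h, has_index x h.
Proof.
move=> Gx; have [x1|[xn|[k [l [kl kx xl]]]]] := zones x.
- by exists 1%N; exact: first_index.
- by exists m.+1; exact: last_index.
- have [g [h [_ Hg _]]] := zone_index kl Gx Gx kx (lexx x) xl.
  by exists g.
Qed.

(** Either a base point separates [x] and [y], and its index separates [g] and [h], or both points
    lie in one zone, where [zone_index] supplies ordered indices that uniqueness identifies with the
    given ones. Before the first and after the last base point the index is extreme. *)
Lemma has_index_mono x y g h : G x -> G y -> x <= y ->
  has_index x g -> has_index y h -> (g <= h)%N.
Proof.
move=> Gx Gy xy Hg Hh.
have [/andP[g0 gm] _ Hg'] := Hg; have [/andP[h0 hm] _ Hh'] := Hh.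
have sep f : regular T t f -> x <= z f -> z f <= y -> (g <= h)%N.
  move=> rf xf fy; have [_ /(_ xf) gf] := Hg' _ rf.
  by have [/(_ fy) fh _] := Hh' _ rf; exact: leq_trans fh.
have r1 := regular1 T_gt0 uat; have rn := regular_last T_gt0 uat.
have [x1|[xn|[k [l [kl kx xl]]]]] := zones x.
- by rewrite (has_index_uniq Hg (first_index Gx x1)).
- by rewrite (has_index_uniq Hh (last_index Gy (le_trans xn xy))).
- have [yl|ly] := ltP y (z l); last first.
    by have [_ rl _ _] := kl; exact: sep rl (ltW xl) ly.
  have [g' [h' [gh Hxg Hyh]]] := zone_index kl Gx Gy kx xy yl.
  by rewrite (has_index_uniq Hg Hxg) (has_index_uniq Hh Hyh).
Qed.

End MonotoneLevels.

(** * Reconstruction of the switching points *)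

Section Reconstruction.
Context {R : realType} {M m : nat}.
Variables (T : R) (a : 'I_m.+1 -> 'rV[R]_M) (G : R -> Prop).
Variables (w : R -> 'rV[R]_M) (idx : R -> nat).
Hypotheses (T_gt0 : 0 < T) (G_sub : forall x, G x -> x \in `]0, T[).
Hypothesis idx_bounds : forall x, G x -> (0 < idx x <= m.+1)%N.
Hypothesis idx_level : forall x, G x -> w x = level a (idx x).
Hypothesis idx_mono : forall x y, G x -> G y -> x <= y -> (idx x <= idx y)%N.
Local Arguments node : simpl never.

(** Adjoining T keeps the set nonempty, so that the infimum is meaningful, and makes it T when no
    index exceeds [k]. *)
Definition switch_time k : R := inf ([set x | G x /\ (k < idx x)%N] `|` [set T]).

Definition switch_row : 'rV[R]_m := \row_(i < m) switch_time i.+1.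

Let lbound_switch k : has_lbound ([set x | G x /\ (k < idx x)%N] `|` [set T]).
Proof.
exists 0 => x [[/G_sub + _]|->]; last exact: ltW.
by rewrite in_itv/= => /andP[/ltW].
Qed.

Lemma node_switch_le k x : G x -> (k < idx x)%N -> node T switch_row k <= x.
Proof.
move=> Gx kx; case: k kx => [|k] kx.
  by move: (G_sub Gx); rewrite in_itv/= => /andP[/ltW].
have km : (k < m)%N.
  by move: (idx_bounds Gx) => /andP[_] xm; have := leq_trans kx xm.
rewrite (node_ord T switch_row (Ordinal km)) mxE.
by apply: ge_inf; [exact: lbound_switch|left].
Qed.

Lemma node_switch_leT k : node T switch_row k <= T.
Proof.
have [mk|km] := ltnP m k; first by rewrite node_gt.
case: k km => [_|k km]; first exact: ltW.
rewrite (node_ord T switch_row (Ordinal km)) mxE.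
by apply: ge_inf; [exact: lbound_switch|right].
Qed.

Lemma node_switch_ge k c : (0 < k)%N -> c <= T ->
  (forall x, G x -> (k < idx x)%N -> c <= x) -> c <= node T switch_row k.
Proof.
move=> k0 cT H; have [mk|km] := ltnP m k; first by rewrite node_gt.
case: k k0 km H => // k _ km H.
rewrite (node_ord T switch_row (Ordinal km)) mxE; apply: lb_le_inf.
  by exists T; right.
by move=> x [[Gx kx]|->//]; exact: H.
Qed.

Lemma feasible_switch : feasible T switch_row.
Proof.
move=> k km; apply: node_switch_ge => //; first exact: node_switch_leT.
by move=> x Gx kx; apply: node_switch_le => //; exact: ltn_trans kx.
Qed.

(** Serves twice: off the nodes it identifies [w] with the new step function, and at base points it
    shows that the new pieces, closed up, still contain them. *)
Lemma node_switch_sep k x : (0 < k)%N -> G x -> idx x = k ->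
  node T switch_row k.-1 <= x <= node T switch_row k.
Proof.
move=> k0 Gx xk; apply/andP; split.
  by apply: node_switch_le => //; rewrite xk prednK.
apply: node_switch_ge => //.
  by move: (G_sub Gx); rewrite in_itv/= => /andP[_ /ltW].
move=> y Gy ky; rewrite leNgt; apply/negP => /ltW yx.
by have := idx_mono Gy Gx yx; rewrite xk leqNgt ky.
Qed.

(** At a node the index may belong to the piece on either side; the nodes are excluded at the price
    of a null set. *)
Lemma vfun_switch x : G x -> (forall k, x != node T switch_row k) ->
  w x = vfun T switch_row a x.
Proof.
move=> Gx xn; have xT := G_sub Gx; have /andP[i0 im] := idx_bounds Gx.
rewrite (vfunE feasible_switch xT) (idx_level Gx).
have /andP[h1 h2] := node_switch_sep i0 Gx erefl.
rewrite (@kappa_eq _ _ _ _ _ feasible_switch xT (idx x)) ?i0//.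
by rewrite lt_neqAle xn.
Qed.

End Reconstruction.

(** * L^1 norms and unit steps *)

Section L1.
Context {R : realType} {M : nat}.
Notation mu := (@lebesgue_measure R).
Implicit Types (T : R) (u w : R -> 'rV[R]_M).

Lemma ae_neq_point (c : R) : {ae mu, forall x : R, x != c}.
Proof.
exists [set c]; split=> //; first exact: lebesgue_measure_set1.
by move=> x /= /negP; rewrite negbK => /eqP.
Qed.

Lemma ae_neq_points (c : nat -> R) n :
  {ae mu, forall x : R, forall k, (k < n)%N -> x != c k}.
Proof.
elim: n => [|n IH]; first exact: aeW.
apply: lebesgue_aeS (lebesgue_aeI IH (ae_neq_point (c n))) => x [H xn] k.
by rewrite ltnS leq_eqVlt => /predU1P[->|/H].
Qed.

Lemma inL1B T u w : inL1 T u -> inL1 T w -> inL1 T (u - w).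
Proof.
move=> uL wL i.
rewrite (_ : (fun _ => _) = (fun x => (u x 0 i)%:E) \- (fun x => (w x 0 i)%:E))%E.
  by apply: integrableB.
by apply/funext => x; rewrite !mxE.
Qed.

Lemma integrable_vnorm1 T u : inL1 T u ->
  mu.-integrable `]0, T[%classic (EFin \o (fun x => vnorm 1%:E (u x))).
Proof.
move=> uL.
rewrite (_ : _ \o _ = (fun x => \sum_(i <- index_enum 'I_M) `|u x 0 i|%:E)%E); last first.
  by apply/funext => x; rewrite -[LHS]/((vnorm 1%:E (u x))%:E) vnorm1E -sumEFin.
apply: integrable_sum => // i _; apply: integrable_norm; exact: uL.
Qed.

Lemma L1norm_ae T u w : ae_equal T u w -> inL1 T u -> inL1 T w ->
  L1norm T u = L1norm T w.
Proof.
move=> uw uL wL.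
refine (congr1 fine _).
apply: ae_eq_integral => //.
- exact: measurable_int (integrable_vnorm1 uL).
- exact: measurable_int (integrable_vnorm1 wL).
- by apply: lebesgue_aeS uw => x H /= xT; rewrite H.
Qed.

Lemma L1norm_ge T u (f : R -> R) : inL1 T u ->
  mu.-integrable `]0, T[%classic (EFin \o f) -> (forall x, 0 <= f x) ->
  {ae mu, forall x : R, x \in `]0, T[ -> f x <= vnorm 1%:E (u x)} ->
  \int[mu]_(x in `]0, T[%classic) f x <= L1norm T u.
Proof.
move=> uL fi f0 fu; have ui := integrable_vnorm1 uL.
rewrite /L1norm /Rintegral fine_le//; [exact: integrable_fin_num fi|
  exact: integrable_fin_num ui|].
apply: ae_ge0_le_integral => //.
- by move=> x _; rewrite lee_fin.
- exact: measurable_int fi.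
- by move=> x _; rewrite lee_fin; exact: vnorm_ge0.
- exact: measurable_int ui.
Qed.

Lemma integrable_step T (c : R) :
  mu.-integrable `]0, T[%classic (EFin \o (fun x => (c <= x)%R%:R)).
Proof.
rewrite (_ : _ \o _ = EFin \o \1_(`[c, +oo[%classic)); last first.
  by apply/funext => x /=; rewrite indicE mem_setE in_itv/= andbT.
apply: measurable_bounded_integrable => //.
- rewrite [X in (X < _)%E](lebesgue_measure_itv `]0, T[).
  by case: ifP => // _; rewrite -EFinD ltry.
- exists 1; split=> // d d1 x _ /=; rewrite indicE.
  by case: (_ \in _); rewrite ?normr1 ?normr0 ltW// (lt_trans ltr01).
Qed.

Lemma integrable_step_dist T (c d : R) : mu.-integrable `]0, T[%classic
  (EFin \o (fun x => `|(c <= x)%R%:R - (d <= x)%R%:R|)).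
Proof.
pose f (e x : R) : R := (e <= x)%R%:R.
have h : mu.-integrable `]0, T[%classic ((EFin \o f c) \- (EFin \o f d))%E.
  by apply: integrableB => //; exact: integrable_step.
have {}h : mu.-integrable `]0, T[%classic (EFin \o (fun x => f c x - f d x)).
  by apply: eq_integrable h.
exact: integrable_norm h.
Qed.

Lemma Rintegral_step T (c : R) : 0 <= c <= T ->
  \int[mu]_(x in `]0, T[%classic) (c <= x)%R%:R = T - c.
Proof.
move=> cT; have did : derive1 (@id R) = cst 1 by apply/funext => x; exact: derive1_id.
have <- := @Rintegral_derive1_from _ (@id R) T c cT; last 2 first.
- by move=> x; exact: derivable_id.
- by rewrite did => x; exact: cvg_cst.
by apply: eq_Rintegral => x _; rewrite did mulr1.
Qed.

(** The link between L^1 distances and switching points; it also gives the length of a piece, as the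
    distance of the unit steps at its two nodes. *)
Lemma Rintegral_step_dist T (c d : R) : 0 <= c <= T -> 0 <= d <= T ->
  \int[mu]_(x in `]0, T[%classic) `|(c <= x)%R%:R - (d <= x)%R%:R| = `|c - d|.
Proof.
have H c' d' : 0 <= c' <= T -> 0 <= d' <= T -> c' <= d' ->
    \int[mu]_(x in `]0, T[%classic) `|(c' <= x)%R%:R - (d' <= x)%R%:R| = d' - c'.
  move=> cT dT cd; transitivity (\int[mu]_(x in `]0, T[%classic)
      ((c' <= x)%R%:R - (d' <= x)%R%:R)).
    apply: eq_Rintegral => x _; rewrite ger0_norm// subr_ge0.
    by case: (lerP d' x) => [dx|_]; [rewrite (le_trans cd dx)|exact: ler0n].
  rewrite RintegralB//; [|exact: integrable_step..].
  by rewrite !Rintegral_step//; ring.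
move=> cT dT; have [cd|dc] := lerP c d.
  exact: H.
rewrite -(H _ _ dT cT (ltW dc)).
by apply: eq_Rintegral => x _; rewrite distrC.
Qed.

End L1.

(** * Consequences of finiteness and integrality of V *)

Section FiniteValues.
Context {R : realType} {M : nat}.
Variable V : {fset 'rV[int]_M}.
Implicit Types x y : 'rV[R]_M.

Lemma pos_gap (I : finType) (f : I -> R) :
  exists2 d : R, 0 < d & forall i, f i < d -> f i <= 0.
Proof.
suff H (s : seq I) : exists2 d : R, 0 < d & forall i, i \in s -> f i < d -> f i <= 0.
  by have [d d0 Hd] := H (enum I); exists d => // i; apply: Hd; rewrite mem_enum.
elim: s => [|j s [d d0 Hd]]; first by exists 1.
have [fj|fj] := lerP (f j) 0.
  by exists d => // i; rewrite inE => /predU1P[->|/Hd].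
exists (Num.min d (f j)); first by rewrite lt_min d0.
move=> i; rewrite inE lt_min => /predU1P[->|/Hd H /andP[/H]//].
by rewrite ltxx andbF.
Qed.

Lemma valset_sep x y : valset V x -> valset V y -> x != y ->
  exists i, 1 <= `|x 0 i - y 0 i|.
Proof.
move=> [b _ <-] [c _ <-] bc.
have /existsP[i bci] : [exists i, b 0 i != c 0 i].
  rewrite -negb_forall; apply: contra bc => /forallP H.
  by apply/eqP; congr map_mx; apply/rowP => i; apply/eqP.
exists i; rewrite !mxE -rmorphB /= -intr_norm ler1z.
by rewrite -gtz0_ge1 normr_gt0 subr_eq0.
Qed.

Lemma vnorm1_valset x y : valset V x -> valset V y -> x != y ->
  1 <= vnorm 1%:E (x - y).
Proof.
move=> xV yV /(valset_sep xV yV)[i]; have -> : x 0 i - y 0 i = (x - y) 0 i by rewrite !mxE.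
by move=> /le_trans; apply; exact: le_entry_vnorm.
Qed.

Lemma strict_norm_vnorm (p : R) : 1 < p ->
  strict_norm (fun x : 'rV[R]_M => vnorm p%:E x).
Proof.
move=> p1; have p0 := lt_trans ltr01 p1; split.
- exact: vnorm_ge0.
- by move=> x /eqP; rewrite vnorm_eq0// => /eqP.
- by move=> r x; exact: vnormZ.
- exact: vnormD.
- exact: vnormD_eq.
Qed.

(** V has finitely many quadruples, so positive excesses are bounded away from 0. The cap 1 serves
    the second half: distinct integer vectors differ by at least 1 in some entry, and [N] dominates
    entries. *)
Lemma excess_gap_ex (N : 'rV[R]_M -> R) : strict_norm N ->
  (forall x i, `|x 0 i| <= N x) ->
  exists2 delta : R, 0 < delta & excess_gap N V delta.
Proof.
move=> HN Nle; pose r (v : V) : 'rV[R]_M := map_mx intr (val v).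
pose f (q : V * V * V * V) := let: (b, c, d, e) := q in
  N (r c - r b) + N (r d - r c) + N (r e - r d) - N (r e - r b).
have [d d0 Hd] := pos_gap f.
have val_r x : valset V x -> exists v, x = r v.
  by move=> [nu nuV <-]; exists [` nuV]%fset.
exists (Num.min d 1); first by rewrite lt_min d0 ltr01.
split.
  move=> b c d' e /val_r[b' ->] /val_r[c' ->] /val_r[d'' ->] /val_r[e' ->] lt_d.
  have /Hd : f (b', c', d'', e') < d.
    rewrite /f ltrBlDl; apply: lt_le_trans lt_d _.
    by rewrite lerD2l ge_min lexx.
  rewrite /f subr_le0 => le_d; apply/eqP; rewrite eq_le le_d/=.
  apply: le_trans (normB_tri HN _ (r d'') _) _.
  by rewrite lerD2r; exact: normB_tri.
move=> b c bV cV; rewrite lt_min => /andP[_ lt1]; apply/eqP.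
apply: contraTT lt1; rewrite eq_sym => /(valset_sep cV bV)[i].
have -> : c 0 i - b 0 i = (c - b) 0 i by rewrite !mxE.
by move=> /le_trans/(_ (Nle _ _)); rewrite -leNgt.
Qed.

End FiniteValues.

(** * L^1 distance versus displacement of switching points *)

Section L1Switching.
Context {R : realType} {M m : nat}.
Notation mu := (@lebesgue_measure R).
Variables (T : R) (V : {fset 'rV[int]_M}) (u : R -> 'rV[R]_M).
Variables (a : 'I_m.+1 -> 'rV[R]_M) (t : 'rV[R]_m).
Hypotheses (T_gt0 : 0 < T) (uat : full_representation T V u a t).
Local Arguments node : simpl never.

Let ft : feasible T t. Proof. by have [_ _ []] := uat. Qed.

(** Where the unit steps at s_i and t_i differ, [x] has different piece indices for [s] and [t]. No
    regular index f lies strictly between them, because [z f] belongs to the f-th piece for both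
    (closed up for [s]). By [level_neq] the two values differ, hence by at least 1 in the 1-norm. *)
Lemma L1_switching_ge (s : 'rV[R]_m) (z : nat -> R) : feasible T s ->
  (forall k, regular T t k -> node T t k.-1 < z k < node T t k) ->
  (forall k, regular T t k -> node T s k.-1 <= z k <= node T s k) ->
  forall i, `|s 0 i - t 0 i| <= L1norm T (vfun T s a - vfun T t a).
Proof.
move=> fs zt zs i; rewrite -!(node_ord T).
have im : (i.+1 <= m.+1)%N by rewrite ltnS ltnW.
rewrite -(Rintegral_step_dist (node_itv fs im) (node_itv ft im)).
apply: L1norm_ge; [by apply: inL1B; exact: inL1_vfun|exact: integrable_step_dist|by []|].
apply: aeW => x xT; rewrite -!(ltn_kappa _ xT)//.
have [->|kst] := eqVneq (kappa T s x) (kappa T t x).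
  by rewrite subrr normr0 vnorm_ge0.
apply: (@le_trans _ _ 1).
  by do 2 case: (_ < _)%N; rewrite ?subrr ?subr0 ?sub0r ?normrN ?normr1 ?normr0.
rewrite -[(_ - _) x]/(vfun T s a x - vfun T t a x) !vfunE//.
have bs : (0 < kappa T s x <= m.+1)%N by rewrite kappa_gt0// kappa_le.
have bt : (0 < kappa T t x <= m.+1)%N by rewrite kappa_gt0// kappa_le.
apply: (@vnorm1_valset _ _ V); [exact: (valset_level uat)|exact: (valset_level uat)|].
have none f : regular T t f ->
    ~~ (kappa T s x < f < kappa T t x)%N /\ ~~ (kappa T t x < f < kappa T s x)%N.
  move=> rf; have /andP[f0 fm] := regular_bounds rf.
  have /andP[zt1 zt2] := zt _ rf; have /andP[zs1 zs2] := zs _ rf.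
  have fm1 : (f.-1 <= m.+1)%N by rewrite (leq_trans (leq_pred _)).
  have pred_lt k : (k < f)%N -> ~~ (f.-1 < k)%N by move=> kf; rewrite -leqNgt -ltnS prednK.
  split; apply/negP => /andP[/pred_lt + ].
    rewrite !ltn_kappa// -ltNge => xs tx.
    by move: (lt_le_trans (lt_le_trans xs zs1) (le_trans (ltW zt2) tx)); rewrite ltxx.
  rewrite !ltn_kappa// -ltNge => xs tx.
  by move: (lt_trans xs (lt_le_trans zt1 (le_trans zs2 tx))); rewrite ltxx.
have /andP[s0 sm] := bs; have /andP[t0 tm] := bt.
case: (ltngtP (kappa T s x) (kappa T t x)) kst => // lt_k _.
  apply: (level_neq T_gt0 uat) => // f ff; apply/negP => /none[].
  by rewrite ff.
rewrite eq_sym; apply: (level_neq T_gt0 uat) => // f ff; apply/negP => /none[_].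
by rewrite ff.
Qed.

Lemma vnorm1_sum (I : finType) (c : I -> R) (v : I -> 'rV[R]_M) :
  vnorm 1%:E (\sum_k c k *: v k) <= \sum_k vnorm 1%:E (v k) * `|c k|.
Proof.
elim/big_ind2: _ => [|x1 x2 y1 y2 H1 H2|k _]; first by rewrite vnorm0.
  apply: le_trans (lerD H1 H2); rewrite !vnorm1E -big_split.
  by apply: ler_sum => i _; rewrite mxE ler_normD.
by rewrite vnormZ// mulrC.
Qed.

Lemma L1_switching_le (s : 'rV[R]_m) : feasible T s ->
  L1norm T (vfun T s a - vfun T t a) <=
  \sum_(k < m) vnorm 1%:E (jump a k) * `|s 0 k - t 0 k|.
Proof.
move=> fs; pose D (k : 'I_m) x : R :=
  (node T s k.+1 <= x)%R%:R - (node T t k.+1 <= x)%R%:R.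
have Di (k : 'I_m) : mu.-integrable `]0, T[%classic
    (EFin \o (fun x => vnorm 1%:E (jump a k) * `|D k x|)).
  by apply: integrable_scale => //; exact: integrable_step_dist.
apply: (@le_trans _ _ (\int[mu]_(x in `]0, T[%classic)
    \sum_(k < m) vnorm 1%:E (jump a k) * `|D k x|)).
  apply: le_Rintegral => //.
  - by apply: integrable_vnorm1; apply: inL1B; exact: inL1_vfun.
  - rewrite (_ : _ \o _ = (fun x => \sum_(k <- index_enum 'I_m)
      (vnorm 1%:E (jump a k) * `|D k x|)%:E)%E); last first.
      by apply/funext => x; rewrite sumEFin.
    by apply: integrable_sum => // k _; exact: Di.
  - move=> x xT; rewrite -[(_ - _) x]/(vfun T s a x - vfun T t a x).
    rewrite !vfun_jump// opprD addrACA subrr add0r -sumrB.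
    rewrite (eq_bigr (fun k => D k x *: jump a k)); first exact: vnorm1_sum.
    by move=> k _; rewrite -scalerBl.
rewrite Rintegral_sum//; apply: ler_sum => k _.
rewrite RintegralZl//; last exact: integrable_step_dist.
have km : (k.+1 <= m.+1)%N by rewrite ltnS ltnW.
by rewrite /D Rintegral_step_dist ?node_itv// !node_ord.
Qed.

(** Otherwise [w] and [u] take different values in V almost everywhere on the piece, hence differ
    there by at least 1, and the L^1 distance is no less than the length of the piece. *)
Lemma base_point (w : R -> 'rV[R]_M) (G : R -> Prop) k : inL1 T u -> inL1 T w ->
  (forall x, G x -> valset V (w x)) ->
  {ae mu, forall x : R, x \in `]0, T[ -> G x} ->
  regular T t k -> L1norm T (w - u) < node T t k - node T t k.-1 ->
  exists x, [/\ G x, w x = level a k & node T t k.-1 < x < node T t k].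
Proof.
move=> uL wL GV aeG rk; apply: contraPP => Hno; apply/negP; rewrite -leNgt.
have /andP[/andP[k0 km] nk] := rk.
have km1 : (k.-1 <= m.+1)%N by rewrite (leq_trans (leq_pred _)).
rewrite -[leLHS]ger0_norm ?subr_ge0 ?(ltW nk)// distrC.
(* The indicator of the piece is written as the distance of the unit steps at its two nodes. *)
rewrite -(Rintegral_step_dist (node_itv ft km1) (node_itv ft km)).
apply: L1norm_ge; [exact: inL1B|exact: integrable_step_dist|by []|].
have [_ uE _ _] := uat.
apply: lebesgue_aeS (lebesgue_aeI (ae_neq_point (node T t k.-1))
  (lebesgue_aeI aeG uE)) => x [xn [Gx ux]] xT.
have [kx|xk] := leP (node T t k.-1) x; last first.
  by rewrite (lt_geF (lt_trans xk nk)) subrr normr0 vnorm_ge0.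
have [kx'|xk] := leP (node T t k) x; first by rewrite subrr normr0 vnorm_ge0.
rewrite subr0 normr1 -[(w - u) x]/(w x - u x) ux// vfunE//.
rewrite (kappa_eq ft xT (k := k)) ?k0//.
apply: (@vnorm1_valset _ _ V); [exact/GV/Gx|exact: (valset_level uat)|].
apply/eqP => wE; apply: Hno; exists x; split=> //; first exact: Gx.
by rewrite xk andbT lt_neqAle eq_sym xn.
Qed.

End L1Switching.

(** * Local growth *)

Section Nearby.
Context {R : realType} {M : nat}.
Notation mu := (@lebesgue_measure R).

Lemma pairing_ae (T : R) (u w phi : R -> 'rV[R]_M) : inL1 T u -> inL1 T w ->
  ae_equal T u w -> C1c T phi -> pairing T u phi = pairing T w phi.
Proof.
move=> uL wL uw cphi; rewrite !pairingE//; apply: eq_bigr => i _.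
refine (congr1 fine _); apply: ae_eq_integral => //.
- exact: measurable_int (C1c_integrable i uL cphi).
- exact: measurable_int (C1c_integrable i wL cphi).
- by apply: lebesgue_aeS uw => x H /= xT; rewrite H.
Qed.

Lemma TV_ae_le (T p : R) (u w : R -> 'rV[R]_M) : inL1 T u -> inL1 T w ->
  ae_equal T u w -> (TV T p%:E u <= TV T p%:E w)%E.
Proof.
move=> uL wL uw; apply: TV_le => phi adm.
by rewrite (pairing_ae uL wL uw (proj1 adm)); exact: TV_ge.
Qed.

Context {m : nat}.
Variables (T : R) (V : {fset 'rV[int]_M}) (u : R -> 'rV[R]_M) (p : R).
Variables (a : 'I_m.+1 -> 'rV[R]_M) (t : 'rV[R]_m).
Hypotheses (T_gt0 : 0 < T) (uat : full_representation T V u a t).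
Hypotheses (p_gt1 : 1 < p) (u_ad : Uad T V u).
Notation N := (fun x : 'rV[R]_M => vnorm p%:E x).
Local Arguments node : simpl never.

Let ft : feasible T t. Proof. by have [_ _ []] := uat. Qed.
Let uE : ae_equal T u (vfun T t a). Proof. by have [] := uat. Qed.
Let uL : inL1 T u. Proof. by have [[]] := u_ad. Qed.

Definition total_jump : R := \sum_(k < m) vnorm p%:E (jump a k).

(** The index argument is instantiated with the variation of [w] on (0,x) and with the Lebesgue
    points at which [w] lies in V. Closeness to [u] in L^1 enters only through the existence of base
    points. *)
Lemma nearby_switching (delta : R) (w : R -> 'rV[R]_M) :
  excess_gap N V delta -> Uad T V w ->
  (forall k, regular T t k -> L1norm T (w - u) < node T t k - node T t k.-1) ->
  (total_jump%:E <= TV T p%:E w)%E /\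
  ((TV T p%:E w < (total_jump + delta)%:E)%E -> exists s, [/\ feasible T s,
    ae_equal T w (vfun T s a) &
    forall i, `|s 0 i - t 0 i| <= L1norm T (vfun T s a - vfun T t a)]).
Proof.
move=> gap [[wL _] wV] close.
pose G x := interior_lebesgue_pt T w x /\ valset V (w x).
have aeG : {ae mu, forall x : R, x \in `]0, T[ -> G x}.
  apply: lebesgue_aeS (lebesgue_aeI (ae_interior_lebesgue_pt wL) wV) => x [H1 H2] xT.
  by split; [exact: H1|exact: H2].
have GV x : G x -> valset V (w x) by case.
have G_sub x : G x -> x \in `]0, T[ by case=> -[].
have [z zP] : {z : nat -> R & forall k, regular T t k ->
    [/\ G (z k), w (z k) = level a k & node T t k.-1 < z k < node T t k]}.
  apply: (choice (P := fun k x => regular T t k ->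
    [/\ G x, w x = level a k & node T t k.-1 < x < node T t k])) => k.
  have [rk|nrk] := boolP (regular T t k); last by exists 0.
  by have [x xP] := base_point uat uL wL GV aeG rk (close k rk); exists x.
have TV0 := TV_ge0 p_gt1 wL.
have [fin|] := boolP (TV T p%:E w \is a fin_num); last first.
  rewrite ge0_fin_numE// -leNgt leye_eq => /eqP ->.
  by split; [exact: leey|rewrite ltNge leey].
(* The absolute value makes [P] nonnegative on all of R, including points beyond T; on [G] it
   changes nothing. *)
pose P x := `|fine (TV x p%:E w)|; pose Q := fine (TV T p%:E w).
have QE : TV T p%:E w = Q%:E by rewrite fineK.
have PE x : G x -> TV x p%:E w = (P x)%:E /\ P x <= Q.
  move=> /G_sub; rewrite in_itv/= => /andP[_ /ltW xT].
  have TVx0 := TV_ge0 p_gt1 (inL1_le xT wL).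
  have TVxT := TV_mono w p_gt1 xT.
  have finx : TV x p%:E w \is a fin_num.
    by rewrite ge0_fin_numE// (le_lt_trans TVxT)// QE ltry.
  have -> : P x = fine (TV x p%:E w) by rewrite /P ger0_norm// fine_ge0.
  by rewrite (fineK finx); split; [by []|exact: (fine_le finx fin TVxT)].
have P_ge0 x : 0 <= P x by exact: normr_ge0.
have P_le x : G x -> P x <= Q by move=> /PE[].
have PD x y : G x -> G y -> x < y -> P x + N (w y - w x) <= P y.
  move=> Gx Gy xy; have [Ex _] := PE _ Gx; have [Ey _] := PE _ Gy.
  rewrite -lee_fin EFinD -Ex -Ey.
  exact: (TV_increment p_gt1 wL (proj1 Gx) (proj1 Gy) xy).
have HN := strict_norm_vnorm (M := M) p_gt1.
have SE : total_jump = level_length a N m.+1 by rewrite level_length_last.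
have tot := total_length_le T_gt0 uat HN P_ge0 P_le PD zP.
split; first by rewrite QE lee_fin SE.
rewrite QE lte_fin SE => Q_lt.
have [idx idxP] : {idx : R -> nat & forall x, G x ->
    has_index T a t w z x (idx x)}.
  apply: (choice (P := fun x h => G x -> has_index T a t w z x h)) => x.
  have [Gx|nGx] := pselect (G x); last by exists 0%N.
  by have [h hP] := has_index_ex T_gt0 uat HN P_ge0 P_le PD zP gap Q_lt GV Gx; exists h.
have idx_mono x y : G x -> G y -> x <= y -> (idx x <= idx y)%N.
  move=> Gx Gy xy; exact: (has_index_mono T_gt0 uat HN P_ge0 P_le PD zP gap Q_lt GV
    Gx Gy xy (idxP _ Gx) (idxP _ Gy)).
have idx_bounds x : G x -> (0 < idx x <= m.+1)%N by move=> /idxP[].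
have idx_level x : G x -> w x = level a (idx x) by move=> /idxP[].
pose s : 'rV[R]_m := switch_row T G idx.
have fs : feasible T s by exact: feasible_switch.
(* By uniqueness, as [k] is an index of [z k]. Hence [z k] also lies in the closed k-th piece for
   [s], as [L1_switching_ge] requires. *)
have idxz k : regular T t k -> idx (z k) = k.
  move=> rk; have [Gk wk _] := zP _ rk.
  apply: (has_index_uniq T_gt0 uat (idxP _ Gk)); split=> //.
    exact: regular_bounds rk.
  by move=> f rf; split; apply: (z_le uat zP).
exists s; split=> //.
- apply: lebesgue_aeS (lebesgue_aeI aeG (ae_neq_points (node T s) m.+2)) => x [Gx xn] xT.
  apply: (vfun_switch T_gt0 G_sub idx_bounds idx_level idx_mono) => // [|k].
    exact: Gx.
  have [km|mk] := ltnP k m.+2; first exact: xn.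
  rewrite node_gt ?(leq_trans _ mk)//; move: xT; rewrite in_itv/= => /andP[_ xT].
  by rewrite lt_eqF.
- apply: (L1_switching_ge T_gt0 uat fs (z := z)).
    by move=> k /zP[].
  move=> k rk; have [Gk _ _] := zP _ rk; have /andP[k0 _] := regular_bounds rk.
  exact: (node_switch_sep T_gt0 G_sub idx_bounds idx_mono k0 Gk (idxz _ rk)).
Qed.

Lemma regular_gap : exists2 d : R, 0 < d &
  forall k, regular T t k -> d <= node T t k - node T t k.-1.
Proof.
have [d d0 H] := pos_gap (fun k : 'I_m.+2 => node T t k - node T t k.-1).
exists d => // k rk; have /andP[/andP[_ km] nk] := rk.
have {}km : (k < m.+2)%N by [].
rewrite leNgt; apply/negP => /(H (Ordinal km)).
by rewrite subr_le0 leNgt nk.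
Qed.

Lemma L1normB_ae (f g h k : R -> 'rV[R]_M) : inL1 T f -> inL1 T g -> inL1 T h ->
  inL1 T k -> ae_equal T f h -> ae_equal T g k -> L1norm T (f - g) = L1norm T (h - k).
Proof.
move=> fL gL hL kL fh gk; apply: L1norm_ae; [|exact: inL1B..].
apply: lebesgue_aeS (lebesgue_aeI fh gk) => x [fx gx] xT.
by rewrite -[LHS]/(f x - g x) fx// gx.
Qed.

Lemma L1norm0 : L1norm T (0 : R -> 'rV[R]_M) = 0.
Proof.
rewrite /L1norm (@eq_Rintegral _ _ _ _ _ (cst 0)).
  by rewrite Rintegral_cst// mul0r.
by move=> x _; rewrite -[X in vnorm _ X]/(0 : 'rV[R]_M) vnorm0.
Qed.

(** The lower bound is [nearby_switching] for [w] = [u], whose distance 0 is below the length of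
    every regular piece. *)
Lemma TV_full_representation : TV T p%:E u = total_jump%:E.
Proof.
apply/eqP; rewrite eq_le; apply/andP; split.
  apply: le_trans (TV_vfun_le a p_gt1 (ltW T_gt0) ft).
  exact: TV_ae_le (inL1_vfun _ _ _) uE.
have [delta _ gap] := excess_gap_ex V (strict_norm_vnorm p_gt1)
  (fun x i => le_entry_vnorm x i (lt_trans ltr01 p_gt1)).
apply: (proj1 (nearby_switching gap u_ad _)) => k /andP[_ nk].
by rewrite subrr L1norm0 subr_gt0.
Qed.

Lemma Uad_vfun s : feasible T s -> Uad T V (vfun T s a).
Proof.
move=> fs; split; first exact: inBV_vfun (ltW T_gt0) fs.
by apply: aeW => x xT; rewrite vfunE//; exact: (valset_level uat).
Qed.

End Nearby.

(** * Transfer of the growth conditions *)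

Section Growth.
Context {R : realType} {M m : nat}.
Variables (T beta : R) (V : {fset 'rV[int]_M}) (F : (R -> 'rV[R]_M) -> R).
Variables (p : R) (u : R -> 'rV[R]_M).
Variables (a : 'I_m.+1 -> 'rV[R]_M) (t : 'rV[R]_m).
Hypotheses (T_gt0 : 0 < T) (beta_gt0 : 0 < beta) (F_ae : ae_invariant T F).
Hypothesis (F_lsc : L1_lower_semicontinuous T F).
Hypotheses (p_gt1 : 1 < p) (u_ad : Uad T V u).
Hypothesis (uat : full_representation T V u a t).
Local Arguments node : simpl never.

Let ft : feasible T t. Proof. by have [_ _ []] := uat. Qed.
Let uE : ae_equal T u (vfun T t a). Proof. by have [] := uat. Qed.
Let uL : inL1 T u. Proof. by have [[]] := u_ad. Qed.
Let vL s : inL1 T (vfun T s a). Proof. exact: inL1_vfun. Qed.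

(* Local optimality is the case [eta = 0] of the two growth conditions. *)
Definition growth_P (eta : R) : Prop := exists2 e : R, 0 < e &
  forall w, Uad T V w -> L1norm T (w - u) <= e ->
    (objective T beta p%:E F u + (eta / 2 * L1norm T (w - u) ^+ 2)%:E
       <= objective T beta p%:E F w)%E.

Definition growth_ST (eta : R) : Prop := exists2 e : R, 0 < e &
  forall s, feasible T s -> vnorm 2%:E (s - t) <= e ->
    F u + eta / 2 * vnorm 2%:E (s - t) ^+ 2 <= F (vfun T s a).

Let S := total_jump p a.
Let Cjump : R := \sum_(k < m) vnorm 1%:E (jump a k).

Lemma Cjump_ge0 : 0 <= Cjump.
Proof. by apply: sumr_ge0 => k _; exact: vnorm_ge0. Qed.

Lemma L1norm_vfun s : L1norm T (vfun T s a - u) = L1norm T (vfun T s a - vfun T t a).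
Proof. by apply: L1normB_ae => //; exact: aeW. Qed.

Lemma L1norm_ge0 (w : R -> 'rV[R]_M) : 0 <= L1norm T w.
Proof. by apply: Rintegral_ge0 => x _; exact: vnorm_ge0. Qed.

Lemma L1norm_vfun_le s : feasible T s ->
  L1norm T (vfun T s a - u) <= Cjump * vnorm 2%:E (s - t).
Proof.
move=> fs; rewrite L1norm_vfun; apply: le_trans (L1_switching_le uat fs) _.
rewrite /Cjump mulr_suml; apply: ler_sum => k _.
apply: ler_wpM2l; first exact: vnorm_ge0.
have -> : s 0 k - t 0 k = (s - t) 0 k by rewrite !mxE.
exact: le_entry_vnorm.
Qed.

Lemma vnorm2_le (x : 'rV[R]_m) (l : R) :
  (forall i, `|x 0 i| <= l) -> vnorm 2%:E x <= m%:R * l.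
Proof.
move=> xl; rewrite (row_sum_delta x).
apply: (@le_trans _ _ (\sum_(k < m) `|x 0 k|)).
  have p1 : 1 < 2 :> R by rewrite ltr1n.
  elim/big_ind2: _ => [|x1 x2 y1 y2 H1 H2|k _]; first by rewrite vnorm0.
    exact: le_trans (vnormD p1 _ _) (lerD H1 H2).
  rewrite vnormZ// vnormE (bigD1 k)//= mxE !eqxx normr1 powR1 big1.
    by rewrite addr0 powR1 mulr1.
  by move=> i ik; rewrite mxE eqxx (negbTE ik) normr0 powR0.
rewrite mulr_natl -[m in leRHS]card_ord -sumr_const.
by apply: ler_sum => k _; exact: xl.
Qed.

Lemma objective_u : objective T beta p%:E F u = (F u + beta * S)%:E.
Proof. by rewrite /objective (TV_full_representation T_gt0 uat p_gt1 u_ad). Qed.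

Lemma objective_ge (w : R -> 'rV[R]_M) (c : R) : (c%:E <= TV T p%:E w)%E ->
  ((F w + beta * c)%:E <= objective T beta p%:E F w)%E.
Proof.
by move=> cTV; rewrite EFinD EFinM leeD2l// lee_wpmul2l// lee_fin ltW.
Qed.

Lemma objective_vfun_le s : feasible T s ->
  (objective T beta p%:E F (vfun T s a) <= (F (vfun T s a) + beta * S)%:E)%E.
Proof.
move=> fs; rewrite EFinD EFinM leeD2l// lee_wpmul2l ?lee_fin ?(ltW beta_gt0)//.
exact: TV_vfun_le (ltW T_gt0) fs.
Qed.

(** Regular pieces have length at least [d]; as long as no node moves by more than d / 2, their
    midpoints stay in their closed pieces and serve as base points. *)
Lemma near_switching_ge : exists2 e : R, 0 < e & forall s, feasible T s ->
  vnorm 2%:E (s - t) <= e ->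
  vnorm 2%:E (s - t) <= m%:R * L1norm T (vfun T s a - u).
Proof.
have [d d0 dP] := regular_gap T t; exists (d / 2); first by rewrite divr_gt0.
move=> s fs st; apply: vnorm2_le => i; rewrite !mxE L1norm_vfun.
pose z k := (node T t k.-1 + node T t k) / 2.
apply: (L1_switching_ge T_gt0 uat fs (z := z)) => k rk.
  by have /andP[_ nk] := rk; rewrite /z; apply/andP; split; lra.
have nd j : `|node T s j - node T t j| <= d / 2.
  case: j => [|j]; first by rewrite subrr normr0 divr_ge0// ltW.
  have [jm|mj] := ltnP j m; last by rewrite !node_gt// subrr normr0 divr_ge0// ltW.
  rewrite !(node_ord _ _ (Ordinal jm)); apply: le_trans st.
  have -> : s 0 (Ordinal jm) - t 0 (Ordinal jm) = (s - t) 0 (Ordinal jm) by rewrite !mxE.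
  exact: le_entry_vnorm.
have := nd k; have := nd k.-1; have := dP k rk.
by rewrite !ler_norml /z => h /andP[h1 h2] /andP[h3 h4]; apply/andP; split; lra.
Qed.

Lemma mul_le_div (k x e : R) : 0 <= k -> 0 <= x -> x <= e / (k + 1) -> k * x <= e.
Proof.
move=> k0 x0; have k1 : 0 < k + 1 by rewrite ltr_wpDl.
rewrite ler_pdivlMr// => xe; apply: le_trans xe; rewrite mulrC.
by apply: ler_wpM2l => //; rewrite lerDl.
Qed.

Lemma drop_common (x y b c d : R) : x + b + c <= y + b -> d <= c -> x + d <= y.
Proof. by move=> *; lra. Qed.

Lemma add_common (x y b c d : R) : x + c <= y -> d <= c -> x + b + d <= y + b.
Proof. by move=> *; lra. Qed.

Lemma add_gap (x y b c d : R) :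
  x - d / 2 < y -> c <= d / 2 -> x + b + c <= y + (b + d).
Proof. by move=> h1 h2; have := lerB (lexx (d / 2)) h2; lra. Qed.

Lemma scale_growth (eta k x y : R) : 0 <= eta -> 0 < k -> 0 <= x ->
  x <= k * y -> eta / k ^+ 2 / 2 * x ^+ 2 <= eta / 2 * y ^+ 2.
Proof.
move=> eta0 k0 x0 xy.
have -> : eta / k ^+ 2 / 2 * x ^+ 2 = eta / 2 * (x / k) ^+ 2.
  by field; rewrite gt_eqF.
apply: ler_wpM2l; first by rewrite divr_ge0.
have xky : x / k <= y by rewrite ler_pdivrMr// mulrC.
have xk0 : 0 <= x / k by rewrite divr_ge0// ltW.
by apply: lerXn2r; rewrite ?nnegrE// (le_trans xk0).
Qed.

(** The variation cancels: it equals [S] for [u] and is at most [S] after moving the nodes. Taking m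
    + 1 instead of m keeps the constant meaningful when there are no switching points. *)
Lemma growth_P_ST (eta : R) : 0 <= eta -> growth_P eta ->
  growth_ST (eta / (m%:R + 1) ^+ 2).
Proof.
move=> eta0 [e e0 eP]; have [e1 e10 e1P] := near_switching_ge.
have C0 := Cjump_ge0; have C1 : 0 < Cjump + 1 by rewrite ltr_wpDl.
exists (Num.min e1 (e / (Cjump + 1))); first by rewrite lt_min e10 divr_gt0.
move=> s fs; rewrite le_min => /andP[se1 se].
have v0 := vnorm_ge0 2 (s - t).
have Ls : L1norm T (vfun T s a - u) <= e.
  apply: le_trans (L1norm_vfun_le fs) _.
  exact: mul_le_div C0 v0 se.
have := le_trans (eP _ (Uad_vfun T_gt0 uat fs) Ls) (objective_vfun_le fs).
rewrite objective_u -EFinD lee_fin => H.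
have L0 := L1norm_ge0 (vfun T s a - u).
have vL1 : vnorm 2%:E (s - t) <= (m%:R + 1) * L1norm T (vfun T s a - u).
  apply: le_trans (e1P _ fs se1) _.
  by apply: ler_wpM2r => //; rewrite lerDl.
have m1 : 0 < (m%:R + 1 : R) by rewrite ltr_wpDl.
have : eta / (m%:R + 1) ^+ 2 / 2 * vnorm 2%:E (s - t) ^+ 2 <=
    eta / 2 * L1norm T (vfun T s a - u) ^+ 2.
  exact: scale_growth.
by move=> h; exact: drop_common H h.
Qed.

(** A single [f] with f(0) = 0 serves local optimality and quadratic growth alike. *)
Lemma growth_ST_P : exists f : R -> R, [/\ f 0 = 0, forall eta, 0 < eta -> 0 < f eta
  & forall eta, 0 <= eta -> growth_ST eta -> growth_P (f eta)].
Proof.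
have C0 := Cjump_ge0; have C1 : 0 < Cjump + 1 by rewrite ltr_wpDl.
have [delta delta0 gap] := excess_gap_ex V (strict_norm_vnorm p_gt1)
  (fun x i => le_entry_vnorm x i (lt_trans ltr01 p_gt1)).
have bd : 0 < beta * delta by rewrite mulr_gt0.
(* The first term comes from the Lipschitz bound of the L^1 distance by |s - t|, for [w] equal to
   some [vfun T s a]; the second from the gain in variation for all other [w]. *)
exists (fun eta => Num.min (eta / (Cjump + 1) ^+ 2) (beta * delta)); split.
- by rewrite mul0r; apply/min_idPl/ltW.
- by move=> eta eta0; rewrite lt_min bd andbT divr_gt0// exprn_gt0.
move=> eta eta0 [e e0 eP].
have [d d0 dP] := regular_gap T t.
(* Lower semicontinuity may cost half of the gain beta * delta; the other half pays for the
   quadratic term. *)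
have [r r0 rP] := F_lsc uL (divr_gt0 bd (ltr0n R 2)).
have m1 : 0 < (m%:R + 1 : R) by rewrite ltr_wpDl.
(* In turn: base points exist in all regular pieces; the recovered [s] is within [e] of [t];
   semicontinuity applies; the squared distance is at most 1. The halves turn weak into strict
   inequalities. *)
exists (Num.min (Num.min (d / 2) (e / (m%:R + 1))) (Num.min (r / 2) 1)).
  by rewrite !lt_min ltr01 !divr_gt0.
move=> w wad; rewrite !le_min => /andP[/andP[wd we] /andP[wr w1]].
have [[wL _] _] := wad; have L0 := L1norm_ge0 (w - u).
set eta' := Num.min _ _.
have eta'1 : eta' <= eta / (Cjump + 1) ^+ 2 by rewrite ge_min lexx.
have eta'2 : eta' <= beta * delta by rewrite ge_min lexx orbT.
have eta'0 : 0 <= eta' by rewrite le_min (ltW bd) andbT divr_ge0// exprn_ge0// ltW.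
have [|TVge near] := nearby_switching T_gt0 uat p_gt1 u_ad gap wad.
  move=> k /dP; apply: lt_le_trans; apply: le_lt_trans wd _.
  by rewrite ltr_pdivrMr// ltr_pMr// ltr1n.
rewrite objective_u -EFinD.
have [TVd|/near[s [fs wE st]]] := leP (total_jump p a + delta)%:E (TV T p%:E w).
  apply: le_trans (objective_ge TVd); rewrite lee_fin.
  have Fw : F u - beta * delta / 2 < F w.
    apply: rP => //; apply: le_lt_trans wr _.
    by rewrite ltr_pdivrMr// ltr_pMr// ltr1n.
  have q1 : L1norm T (w - u) ^+ 2 <= 1 by rewrite expr_le1.
  have : eta' / 2 * L1norm T (w - u) ^+ 2 <= beta * delta / 2.
    rewrite -[leRHS]mulr1; apply: ler_pM => //.
    - by rewrite divr_ge0.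
    - exact: exprn_ge0.
    - by rewrite ler_pM2r.
  rewrite mulrDr => h; exact: add_gap Fw h.
apply: le_trans (objective_ge TVge); rewrite lee_fin.
rewrite (F_ae wL (vL s) wE).
have LE : L1norm T (w - u) = L1norm T (vfun T s a - u).
  by apply: L1normB_ae => //; exact: aeW.
have LE' := L1norm_vfun s; rewrite -LE in LE'; rewrite -LE' in st.
have vs : vnorm 2%:E (s - t) <= e.
  apply: (@le_trans _ _ (m%:R * L1norm T (w - u))).
    by apply: vnorm2_le => i; move: (st i); rewrite !mxE.
  exact: mul_le_div (ler0n _ _) L0 we.
have Lv : L1norm T (w - u) <= (Cjump + 1) * vnorm 2%:E (s - t).
  rewrite LE; apply: le_trans (L1norm_vfun_le fs) _.
  by apply: ler_wpM2r; [exact: vnorm_ge0|rewrite lerDl].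
have : eta' / 2 * L1norm T (w - u) ^+ 2 <= eta / 2 * vnorm 2%:E (s - t) ^+ 2.
  apply: le_trans (scale_growth eta0 C1 L0 Lv).
  by apply: ler_wpM2r; [exact: exprn_ge0|rewrite ler_pM2r].
by move=> h; exact: add_common (eP s fs vs) h.
Qed.

End Growth.

Theorem theorem4p5 (R : realType) (T : R) (M : nat) (beta : R)
    (V : {fset 'rV[int]_M}) (F : (R -> 'rV[R]_M) -> R) (p : R)
    (T_gt0 : 0 < T) (beta_gt0 : 0 < beta) (V_ge2 : (2 <= #|` V|)%N)
    (F_ae : ae_invariant T F)
    (F_bounded : bounded_below T F)
    (F_lsc : L1_lower_semicontinuous T F)
    (F_gateaux : gateaux_differentiable T F)
    (p_gt1 : 1 < p)
    (u : R -> 'rV[R]_M) (u_ad : Uad T V u)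
    (m : nat) (a : 'I_m.+1 -> 'rV[R]_M) (t : 'rV[R]_m)
    (uat : full_representation T V u a t) :
  (locally_optimal_P T V beta p%:E F u <-> locally_optimal_ST T F a t) /\
  (quadratic_growth_P T V beta p%:E F u <-> quadratic_growth_ST T F u a t).
Proof.
have [_ uE [ft _] _] := uat; have [[uL _] _] := u_ad.
have toST := growth_P_ST T_gt0 beta_gt0 p_gt1 u_ad uat (F := F).
have [f [f0 f_gt0 toP]] := growth_ST_P T_gt0 beta_gt0 F_ae F_lsc p_gt1 u_ad uat.
have m1 : 0 < (m%:R + 1 : R) ^+ 2 by rewrite exprn_gt0// ltr_wpDl.
split; split.
- move=> [e e0 eP]; split=> //.
  have [|e1 e10 e1P] := toST 0 (lexx _).
    by exists e => // w wad we; rewrite !mul0r adde0; exact: eP.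
  exists e1 => // s fs se; rewrite -(F_ae _ _ uL (inL1_vfun T t a) uE).
  by have := e1P s fs se; rewrite !mul0r addr0.
- move=> [_ [e e0 eP]]; have [|e1 e10 e1P] := toP 0 (lexx _).
    exists e => // s fs se; rewrite !mul0r addr0.
    by rewrite (F_ae _ _ uL (inL1_vfun T t a) uE); exact: eP.
  exists e1 => // w wad we.
  by have := e1P w wad we; rewrite f0 !mul0r adde0.
- move=> [e [eta [e0 eta0 eP]]].
  have [|e1 e10 e1P] := toST eta (ltW eta0); first by exists e.
  by exists e1, (eta / (m%:R + 1) ^+ 2); split=> //; rewrite divr_gt0.
- move=> [e [eta [e0 eta0 eP]]].
  have [|e1 e10 e1P] := toP eta (ltW eta0); first by exists e.
  by exists e1, (f eta); split=> //; exact: f_gt0.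
Qed.
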